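(* For a connected, locally path connected space $X$ (with base point $x\in X$), there is a 1-1 correspondence between its equivalence classes of connected covering spaces and the conjugacy classes of subgroups of its fundamental group $\pi_1(X,x)$ with open core in $\pi_1^{qtop}(X,x)$.
   Context: The quasitopological fundamental group $\pi_1^{qtop}(X,x)$ is the group $\pi_1(X,x)$ with the quotient topology induced by the map $q:\Omega(X,x)\to\pi_1(X,x)$, $q(\gamma)=[\gamma]$, where $\Omega(X,x)$ is the space of loops in $X$ based at $x$ with the compact-open topology. For a subgroup $H$ of $G=\pi_1(X,x)$, the core of $H$ in $G$ is $H_G=\bigcap_{g\in G}g^{-1}Hg$, the largest normal subgroup of $G$ contained in $H$. ''$H$ has open core in $\pi_1^{qtop}(X,x)$'' means that $H_G$ is an open subset of $\pi_1^{qtop}(X,x)$. Two coverings $p:\widetilde{X}\to X$ and $r:\widetilde{Y}\to X$ are equivalent if there is a homeomorphism $h:\widetilde{X}\to\widetilde{Y}$ with $r\circ h=p$. *)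

(* Defs.v *)
From HB Require Import structures.
From mathcomp Require Import all_boot all_order all_algebra.
From mathcomp Require Import generic_quotient.
From mathcomp Require Import all_classical all_reals.
From mathcomp Require Import topology normedtype homotopy.
From mathcomp Require Import ring lra.

Set Implicit Arguments.
Unset Strict Implicit.
Unset Printing Implicit Defensive.
Import Order.TTheory GRing.Theory Num.Theory.
Import numFieldNormedType.Exports.
Local Open Scope classical_set_scope.
Local Open Scope ring_scope.
Local Open Scope quotient_scope.

Section UnitInterval.
Context {R : realType}.

Definition unit_interval : Type := set_type (`[0, 1]%classic : set R).

HB.instance Definition _ := Topological.on unit_interval.

Definition coord (t : unit_interval) : R := val t.

Lemma coord_inj : injective coord.
Proof. exact: val_inj. Qed.

Lemma clamp_subproof (r : R) :
  Num.max 0 (Num.min r 1) \in (`[0, 1]%classic : set R).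
Proof.
by apply/mem_set; rewrite /= in_itv /= le_max lexx ge_max ler01 ge_min lexx orbT.
Qed.

(* The retraction of R onto [0, 1].  In [concat_fun] and [reverse_fun] its
   argument always lies in [0, 1]. *)
Definition clamp (r : R) : unit_interval :=
  exist (fun s => s \in (`[0, 1]%classic : set R)) _ (clamp_subproof r).

Lemma coord_clamp (r : R) : 0 <= r <= 1 -> coord (clamp r) = r.
Proof. by move=> /andP[r0 r1]; rewrite /coord /= min_l // max_r. Qed.

Lemma unit_intervalP (t : unit_interval) : 0 <= coord t <= 1.
Proof. by case: t => t t01; move: (set_mem t01); rewrite /= in_itv. Qed.

Lemma coordK (t : unit_interval) : clamp (coord t) = t.
Proof. by apply: coord_inj; rewrite coord_clamp // unit_intervalP. Qed.

Lemma coord_continuous : continuous coord.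
Proof. exact: initial_continuous. Qed.

Lemma clamp_continuous : continuous clamp.
Proof.
apply: continuous_comp_initial.
rewrite (_ : _ \o _ = cst 0 \max (idfun \min cst 1)) // => r.
apply: continuous_max; first exact: cvg_cst.
by apply: continuous_min; [exact: cvg_id|exact: cvg_cst].
Qed.

Lemma clamp01_neq : clamp 0 != clamp 1.
Proof.
apply/eqP => /(congr1 coord); rewrite !coord_clamp ?lexx ?ler01 // => /eqP.
by rewrite eq_sym oner_eq0.
Qed.

HB.instance Definition _ := @isBiPointed.Build unit_interval _ _ clamp01_neq.

End UnitInterval.
Arguments unit_interval : clear implicits.

Lemma paste_continuous (R : realType) (S T : topologicalType) (a : S -> R)
    (f g : S -> T) (c : R) :
  continuous a -> continuous f -> continuous g ->
  (forall s, a s = c -> f s = g s) ->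
  continuous (fun s => if a s <= c then f s else g s).
Proof.
move=> ca cf cg fg s U /=.
have Fs : Filter (nbhs s) := @nbhs_filter S s.
have [asc|asc|asc] := ltgtP (a s) c => Us.
- apply: (@filterS2 _ _ Fs _ _ _ _ (@cvgr_lt _ _ _ Fs _ _ (ca s) _ asc) (cf s U Us)) => s' /= lt_s' Us'.
  by rewrite ltW.
- apply: (@filterS2 _ _ Fs _ _ _ _ (@cvgr_gt _ _ _ Fs _ _ (ca s) _ asc) (cg s U Us)) => s' /= lt_s' Us'.
  by rewrite leNgt lt_s'.
- have Uf := cf s U Us; have Ug := cg s U; rewrite -fg // in Ug.
  apply: (@filterS2 _ _ Fs _ _ _ _ Uf (Ug Us)) => s' /= Ufs' Ugs'.
  by case: ifP.
Qed.

Lemma pair_continuous (S T U : topologicalType) (f : S -> T) (g : S -> U) :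
  continuous f -> continuous g -> continuous (fun s => (f s, g s)).
Proof. by move=> cf cg s; apply: cvg_pair; [exact: cf|exact: cg]. Qed.

Lemma comp_continuous (S T U : topologicalType) (f : S -> T) (g : T -> U) :
  continuous f -> continuous g -> continuous (fun s => g (f s)).
Proof. by move=> cf cg s; exact: (continuous_comp (cf s) (cg _)). Qed.

Section PathHomotopy.
Context {R : realType} {X : topologicalType}.
Local Notation I := (unit_interval R).
Local Notation half := (2^-1 : R).

Lemma scale_continuous (S : topologicalType) (f : S -> R) :
  continuous f -> continuous (fun s => 2 * f s).
Proof. by move=> cf s; apply: cvgM; [exact: cvg_cst|exact: cf]. Qed.

Lemma shift_continuous (S : topologicalType) (f : S -> R) :
  continuous f -> continuous (fun s => 2 * f s - 1).
Proof.
by move=> cf s; apply: cvgB; [exact: scale_continuous|exact: cvg_cst].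
Qed.

Lemma affine_continuous (S : topologicalType) (f : S -> R) (a b : R) :
  continuous f -> continuous (fun s => a * f s + b).
Proof.
move=> cf s; apply: cvgD; last exact: cvg_cst.
by apply: cvgM; [exact: cvg_cst|exact: cf].
Qed.

Lemma opp_continuous (S : topologicalType) (f : S -> R) :
  continuous f -> continuous (fun s => 1 - f s).
Proof. by move=> cf s; apply: cvgB; [exact: cvg_cst|exact: cf]. Qed.

Lemma coord_zero : coord (zero : I) = 0. Proof. by rewrite coord_clamp ?lexx ?ler01. Qed.
Lemma coord_one : coord (one : I) = 1. Proof. by rewrite coord_clamp ?lexx ?ler01. Qed.

Lemma clamp_le0 (r : R) : r <= 0 -> clamp r = zero.
Proof.
move=> r0; apply: coord_inj; rewrite coord_zero /coord /=; apply/max_l.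
by rewrite ge_min r0.
Qed.

Lemma clamp_ge1 (r : R) : 1 <= r -> clamp r = one.
Proof.
by move=> r1; apply: coord_inj; rewrite coord_one /coord /= min_r // max_r.
Qed.

Definition path_homotopic {x y : X} (p q : {path I from x to y}) : Prop :=
  exists H : I * I -> X,
    [/\ continuous H,
        forall s, H (s, zero) = p s,
        forall s, H (s, one) = q s &
        forall t, H (zero, t) = x /\ H (one, t) = y].

Lemma path_homotopic_refl {x y : X} (p : {path I from x to y}) :
  path_homotopic p p.
Proof.
exists (p \o fst); split=> // [|t]; last by rewrite /= path_zero path_one.
by apply: comp_continuous; [move=> s; exact: cvg_fst|exact: cts_fun].
Qed.

Lemma fst_cts : continuous (fst : I * I -> I).
Proof. by move=> s; exact: cvg_fst. Qed.
Lemma snd_cts : continuous (snd : I * I -> I).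
Proof. by move=> s; exact: cvg_snd. Qed.
Lemma vfst_cts : continuous (fun u : I * I => coord u.1).
Proof. exact: comp_continuous fst_cts coord_continuous. Qed.
Lemma vsnd_cts : continuous (fun u : I * I => coord u.2).
Proof. exact: comp_continuous snd_cts coord_continuous. Qed.

Lemma path_homotopic_sym {x y : X} (p q : {path I from x to y}) :
  path_homotopic p q -> path_homotopic q p.
Proof.
move=> [H [cH H0 H1 He]].
exists (fun u => H (u.1, clamp (1 - coord u.2))); split=> [|s|s|t].
- apply: comp_continuous cH; apply: pair_continuous; first exact: fst_cts.
  by apply: comp_continuous clamp_continuous; apply: opp_continuous; exact: vsnd_cts.
- by rewrite coord_zero subr0.
- by rewrite coord_one subrr.
- exact: He.
Qed.

Lemma path_homotopic_trans {x y : X} (p q r : {path I from x to y}) :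
  path_homotopic p q -> path_homotopic q r -> path_homotopic p r.
Proof.
move=> [H [cH H0 H1 He]] [K [cK K0 K1 Ke]].
exists (fun u => if coord u.2 <= half then H (u.1, clamp (2 * coord u.2))
                 else K (u.1, clamp (2 * coord u.2 - 1))); split=> [|s|s|t].
- apply: paste_continuous; first exact: vsnd_cts.
  + apply: comp_continuous cH; apply: pair_continuous; first exact: fst_cts.
    apply: comp_continuous clamp_continuous.
    by apply: scale_continuous; exact: vsnd_cts.
  + apply: comp_continuous cK; apply: pair_continuous; first exact: fst_cts.
    apply: comp_continuous clamp_continuous.
    by apply: shift_continuous; exact: vsnd_cts.
  + by move=> [s t] /= ->; rewrite mulfV ?pnatr_eq0 // subrr H1 K0.
- by rewrite coord_zero invr_ge0 ler0n mulr0 H0.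
- rewrite coord_one ifF; last by apply/negP => h; lra.
  by rewrite mulr1 (_ : 2 - 1 = 1 :> R) ?K1 //; ring.
- by split; case: ifP => _; [apply: (He _).1|apply: (Ke _).1|
    apply: (He _).2|apply: (Ke _).2].
Qed.

Definition concat_fun {x y z : X} (p : {path I from x to y})
    (q : {path I from y to z}) (s : I) : X :=
  if coord s <= 2^-1 then p (clamp (2 * coord s)) else q (clamp (2 * coord s - 1)).

Section concat.
Context {x y z : X} (p : {path I from x to y}) (q : {path I from y to z}).

Lemma concat_cts : continuous (concat_fun p q).
Proof.
apply: paste_continuous; first exact: coord_continuous.
- apply: comp_continuous (@cts_fun _ _ p).
  apply: comp_continuous clamp_continuous.
  by apply: scale_continuous; exact: coord_continuous.
- apply: comp_continuous (@cts_fun _ _ q).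
  apply: comp_continuous clamp_continuous.
  by apply: shift_continuous; exact: coord_continuous.
- by move=> s /= ->; rewrite mulfV ?pnatr_eq0 // subrr path_one path_zero.
Qed.

Lemma concat_zero : concat_fun p q zero = x.
Proof. by rewrite /concat_fun coord_zero invr_ge0 ler0n mulr0 path_zero. Qed.

Lemma concat_one : concat_fun p q one = z.
Proof.
rewrite /concat_fun coord_one ifF; last by apply/negP => h; lra.
by rewrite clamp_ge1 ?path_one //; lra.
Qed.

Definition concat : {path I from x to z} :=
  mk_path concat_cts concat_zero concat_one.

Lemma concatE s : concat s =
  if coord s <= 2^-1 then p (clamp (2 * coord s))
  else q (clamp (2 * coord s - 1)).
Proof. by []. Qed.

Definition reverse_fun (s : I) : X := p (clamp (1 - coord s)).

Lemma reverse_cts : continuous reverse_fun.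
Proof.
apply: comp_continuous (@cts_fun _ _ p).
apply: comp_continuous clamp_continuous.
by apply: opp_continuous; exact: coord_continuous.
Qed.

Lemma reverse_zero : reverse_fun zero = y.
Proof. by rewrite /reverse_fun coord_zero subr0 path_one. Qed.

Lemma reverse_one : reverse_fun one = x.
Proof. by rewrite /reverse_fun coord_one subrr path_zero. Qed.

Definition reverse : {path I from y to x} :=
  mk_path reverse_cts reverse_zero reverse_one.

Lemma reverseE s : reverse s = p (clamp (1 - coord s)).
Proof. by []. Qed.

End concat.

Lemma concat_homotopic {x y z : X} (p p' : {path I from x to y})
    (q q' : {path I from y to z}) :
  path_homotopic p p' -> path_homotopic q q' ->
  path_homotopic (concat p q) (concat p' q').
Proof.
move=> [H [cH H0 H1 He]] [K [cK K0 K1 Ke]].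
exists (fun u => if coord u.1 <= half then H (clamp (2 * coord u.1), u.2)
                 else K (clamp (2 * coord u.1 - 1), u.2)); split=> [|s|s|t].
- apply: paste_continuous; first exact: vfst_cts.
  + apply: comp_continuous cH; apply: pair_continuous; last exact: snd_cts.
    apply: comp_continuous clamp_continuous.
    by apply: scale_continuous; exact: vfst_cts.
  + apply: comp_continuous cK; apply: pair_continuous; last exact: snd_cts.
    apply: comp_continuous clamp_continuous.
    by apply: shift_continuous; exact: vfst_cts.
  + by move=> [s t] /= ->; rewrite mulfV ?pnatr_eq0 // subrr (He _).2 (Ke _).1.
- by rewrite H0 K0.
- by rewrite H1 K1.
- rewrite coord_zero invr_ge0 ler0n mulr0 coord_one ifF; last by apply/negP => h; lra.
  by rewrite (clamp_ge1 (r := 2 * 1 - 1)) ?(He _).1 ?(Ke _).2 //; lra.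
Qed.

Lemma reverse_homotopic {x y : X} (p p' : {path I from x to y}) :
  path_homotopic p p' -> path_homotopic (reverse p) (reverse p').
Proof.
move=> [H [cH H0 H1 He]].
exists (fun u => H (clamp (1 - coord u.1), u.2)); split=> [|s|s|t].
- apply: comp_continuous cH; apply: pair_continuous; last exact: snd_cts.
  by apply: comp_continuous clamp_continuous; apply: opp_continuous; exact: vfst_cts.
- exact: H0.
- exact: H1.
- by rewrite coord_zero coord_one subr0 subrr (He _).1 (He _).2.
Qed.

Lemma reparam_homotopic {x y a b : X} (p : {path I from x to y})
    (phi psi : I -> I) (f g : {path I from a to b}) :
  continuous phi -> continuous psi ->
  phi zero = psi zero -> phi one = psi one ->
  (forall s, f s = p (phi s)) -> (forall s, g s = p (psi s)) ->
  path_homotopic f g.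
Proof.
move=> cphi cpsi e0 e1 fE gE; have cv := @coord_continuous R.
exists (fun u =>
  p (clamp (coord (phi u.1) + coord u.2 * (coord (psi u.1) - coord (phi u.1))))).
split=> [|s|s|t].
- apply: comp_continuous (@cts_fun _ _ p).
  apply: comp_continuous clamp_continuous.
  have c1 : continuous (fun u : I * I => coord (phi u.1)).
    exact: (comp_continuous (comp_continuous fst_cts cphi) cv).
  have c2 : continuous (fun u : I * I => coord (psi u.1)).
    exact: (comp_continuous (comp_continuous fst_cts cpsi) cv).
  move=> u; apply: cvgD; first exact: c1.
  by apply: cvgM; [exact: vsnd_cts|apply: cvgB; [exact: c2|exact: c1]].
- by rewrite /= coord_zero mul0r addr0 coordK fE.
- by rewrite /= coord_one mul1r addrC subrK coordK gE.
- rewrite /= e0 e1 !subrr !mulr0 !addr0 !coordK -gE -gE.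
  by rewrite path_zero path_one.
Qed.

Lemma concatA_homotopic {x y z w : X} (p : {path I from x to y})
    (q : {path I from y to z}) (r : {path I from z to w}) :
  path_homotopic (concat p (concat q r)) (concat (concat p q) r).
Proof.
have cv := @coord_continuous R.
pose phi (s : I) : R := if coord s <= half then
  (if coord s <= half ^+ 2 then 2 * coord s else coord s + half ^+ 2)
  else half * coord s + half.
have eh : half = 1 / 2 by rewrite mul1r.
apply: (reparam_homotopic (p := concat p (concat q r))
          (phi := id) (psi := fun s => clamp (phi s))) => //.
- by move=> s; exact: cvg_id.
- apply: comp_continuous clamp_continuous; apply: paste_continuous => //.
  + apply: paste_continuous => //; first exact: scale_continuous.
      rewrite (_ : (fun s : I => coord s + half ^+ 2) =
                   (fun s => 1 * coord s + half ^+ 2)).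
        exact: affine_continuous.
      by apply/funext => s; rewrite mul1r.
    by move=> s ->; rewrite eh expr2; field.
  + exact: affine_continuous.
  + by move=> s ->; rewrite eh expr2 ifF; [field|apply/negP => h; lra].
- change (zero = clamp (phi zero)).
  rewrite /phi coord_zero invr_ge0 ler0n exprn_ge0 ?invr_ge0 ?ler0n //.
  by rewrite mulr0.
- change (one = clamp (phi one)).
  rewrite /phi coord_one ifF; last by apply/negP => h; lra.
  by rewrite eh mulr1 clamp_ge1 //; lra.
move=> s; have /andP[s0 s1] := unit_intervalP s.
rewrite !concatE /phi eh.
case: ifP => [h1|/negbT]; last first.
  rewrite -ltNge => h1.
  rewrite coord_clamp; last by apply/andP; split; lra.
  rewrite ifF; last by apply/negP => h; lra.
  rewrite coord_clamp; last by apply/andP; split; lra.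
  rewrite ifF; last by apply/negP => h; lra.
  by congr (r (clamp _)); field.
rewrite (coord_clamp (r := 2 * coord s)); last by apply/andP; split; lra.
rewrite expr2; case: ifP => h2.
  have -> : coord s <= 1 / 2 * (1 / 2) by lra.
  by rewrite coord_clamp ?h2 //; apply/andP; split; lra.
have {}h2 : 1 / 2 < 2 * coord s by rewrite ltNge h2.
have -> : (coord s <= 1 / 2 * (1 / 2)) = false by apply/negP => h; lra.
rewrite coord_clamp; last by apply/andP; split; lra.
rewrite ifF; last by apply/negP => h; lra.
rewrite coord_clamp; last by apply/andP; split; lra.
rewrite ifT; last by lra.
by congr (q (clamp _)); field.
Qed.

Lemma concat1p_homotopic {x y : X} (p : {path I from x to y}) :
  path_homotopic (concat (cst x : {path I from x to x}) p) p.
Proof.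
have cv := @coord_continuous R.
apply: (reparam_homotopic (p := p)
  (phi := fun s => clamp (2 * coord s - 1)) (psi := id)) => //.
- by apply: comp_continuous clamp_continuous; exact: shift_continuous.
- by move=> s; exact: cvg_id.
- by apply: clamp_le0; rewrite coord_zero; lra.
- by apply: clamp_ge1; rewrite coord_one; lra.
- move=> s; rewrite concatE; case: ifP => // sh.
  by rewrite (clamp_le0 (r := 2 * coord s - 1)) /= ?path_zero //; lra.
Qed.

Lemma concatp1_homotopic {x y : X} (p : {path I from x to y}) :
  path_homotopic (concat p (cst y : {path I from y to y})) p.
Proof.
have cv := @coord_continuous R.
apply: (reparam_homotopic (p := p)
  (phi := fun s => clamp (2 * coord s)) (psi := id)) => //.
- by apply: comp_continuous clamp_continuous; exact: scale_continuous.
- by move=> s; exact: cvg_id.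
- by apply: clamp_le0; rewrite coord_zero; lra.
- by apply: clamp_ge1; rewrite coord_one; lra.
- move=> s; rewrite concatE; case: ifP => // /negbT.
  by rewrite -ltNge => sh; rewrite (clamp_ge1 (r := 2 * coord s)) /= ?path_one //; lra.
Qed.

Lemma concatpV_homotopic {x y : X} (p : {path I from x to y}) :
  path_homotopic (concat p (reverse p)) (cst x : {path I from x to x}).
Proof.
have cv := @coord_continuous R.
pose phi (s : I) : R := if coord s <= half then 2 * coord s else 2 - 2 * coord s.
have cphi : continuous phi.
  apply: paste_continuous => //; first exact: scale_continuous.
    rewrite (_ : (fun s : I => 2 - 2 * coord s) = (fun s => - 2 * coord s + 2)).
      exact: affine_continuous.
    by apply/funext => s; ring.
  by move=> s ->; lra.
apply: (reparam_homotopic (p := p)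
  (phi := fun s => clamp (phi s)) (psi := fun=> zero)).
- exact: comp_continuous clamp_continuous.
- exact: cst_continuous.
- by apply: clamp_le0; rewrite /phi coord_zero; case: ifP => h; lra.
- by apply: clamp_le0; rewrite /phi coord_one; case: ifP => h; lra.
- move=> s; have /andP[s0 s1] := unit_intervalP s.
  rewrite concatE /phi; case: ifP => // /negbT; rewrite -ltNge => sh.
  rewrite reverseE coord_clamp; last by apply/andP; split; lra.
  by congr (p (clamp _)); ring.
- by move=> s; rewrite path_zero.
Qed.

Lemma reverseK {x y : X} (p : {path I from x to y}) : reverse (reverse p) = p.
Proof.
apply/path_eqP => s; have /andP[s0 s1] := unit_intervalP s.
rewrite !reverseE coord_clamp; last first.
  by apply/andP; split; lra.
by rewrite subKr coordK.
Qed.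

Lemma concatVp_homotopic {x y : X} (p : {path I from x to y}) :
  path_homotopic (concat (reverse p) p) (cst y : {path I from y to y}).
Proof. by rewrite -{2}(reverseK p); exact: concatpV_homotopic. Qed.

End PathHomotopy.

Section FundamentalGroup.
Context (R : realType) {X : topologicalType} (x : X).
Local Notation I := (unit_interval R).

Definition loop_space := {path I from x to x}.
HB.instance Definition _ := Topological.on loop_space.

Lemma loop_space_openE (A : set loop_space) :
  open A = exists2 B : set {compact-open, I -> X},
    open B & (fun p : loop_space => (p : I -> X)) @^-1` B = A.
Proof. by []. Qed.

Definition loop_rel (p q : loop_space) : bool := `[< path_homotopic p q >].

Lemma loop_rel_refl : reflexive loop_rel.
Proof. by move=> p; apply/asboolP; exact: path_homotopic_refl. Qed.

Lemma loop_rel_sym : symmetric loop_rel.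
Proof.
by move=> p q; apply/asboolP/asboolP; exact: path_homotopic_sym.
Qed.

Lemma loop_rel_trans : transitive loop_rel.
Proof.
move=> q p r /asboolP pq /asboolP qr; apply/asboolP.
exact: path_homotopic_trans pq qr.
Qed.

Definition loop_equiv := EquivRel _ loop_rel_refl loop_rel_sym loop_rel_trans.

(* The quasitopological fundamental group: its topology is the quotient of the
   compact-open topology, which in general does not make it a topological
   group. *)
Definition pi1 := {eq_quot loop_equiv}.
HB.instance Definition _ := Topological.copy pi1 (quotient_topology pi1).
HB.instance Definition _ := Quotient.on pi1.

Definition loop_class (p : loop_space) : pi1 := \pi_pi1 p.

Lemma loop_classP (p q : loop_space) :
  loop_class p = loop_class q <-> path_homotopic p q.
Proof.
by split=> [/eqmodP/asboolP|pq]; last by apply/eqmodP/asboolP.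
Qed.

Lemma loop_class_repr (a : pi1) : loop_class (repr a) = a.
Proof. exact: reprK. Qed.

Lemma open_pi1E (A : set pi1) : open A = open (loop_class @^-1` A).
Proof. by []. Qed.

Lemma repr_loop_class (p : loop_space) : path_homotopic (repr (loop_class p)) p.
Proof. by apply/loop_classP; exact: loop_class_repr. Qed.

Definition pi1_one : pi1 := loop_class (cst x).
Definition pi1_mul (a b : pi1) : pi1 := loop_class (concat (repr a) (repr b)).
Definition pi1_inv (a : pi1) : pi1 := loop_class (reverse (repr a)).

Lemma pi1_mulE (p q : loop_space) :
  pi1_mul (loop_class p) (loop_class q) = loop_class (concat p q).
Proof. by apply/loop_classP; apply: concat_homotopic; exact: repr_loop_class. Qed.

Lemma pi1_invE (p : loop_space) :
  pi1_inv (loop_class p) = loop_class (reverse p).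
Proof. by apply/loop_classP; apply: reverse_homotopic; exact: repr_loop_class. Qed.

Lemma pi1_mulA : associative pi1_mul.
Proof.
move=> a b c.
rewrite -(loop_class_repr a) -(loop_class_repr b) -(loop_class_repr c).
by rewrite !pi1_mulE; apply/loop_classP; exact: concatA_homotopic.
Qed.

Lemma pi1_mul1g : left_id pi1_one pi1_mul.
Proof.
move=> a; rewrite -(loop_class_repr a) pi1_mulE.
by apply/loop_classP; exact: concat1p_homotopic.
Qed.

Lemma pi1_mulg1 : right_id pi1_one pi1_mul.
Proof.
move=> a; rewrite -(loop_class_repr a) pi1_mulE.
by apply/loop_classP; exact: concatp1_homotopic.
Qed.

Lemma pi1_mulVg : left_inverse pi1_one pi1_inv pi1_mul.
Proof.
move=> a; rewrite -(loop_class_repr a) pi1_invE pi1_mulE.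
by apply/loop_classP; exact: concatVp_homotopic.
Qed.

Lemma pi1_mulgV : right_inverse pi1_one pi1_inv pi1_mul.
Proof.
move=> a; rewrite -(loop_class_repr a) pi1_invE pi1_mulE.
by apply/loop_classP; exact: concatpV_homotopic.
Qed.

HB.instance Definition _ := isGroup.Build pi1
  pi1_mulA pi1_mul1g pi1_mulg1 pi1_mulVg pi1_mulgV.

End FundamentalGroup.

Section Subgroups.
Context {G : groupType}.
Implicit Type H : set G.

Definition subgroup H := group_closed [in H].

Definition conj_set H (g : G) : set G := [set (h ^ g)%g | h in H].

Definition core H : set G := \bigcap_g conj_set H g.

Definition conj_class H : set (set G) := range (conj_set H).

End Subgroups.

Definition open_core_classes (R : realType) (X : topologicalType) (x : X) :
    set (set (set (pi1 R x))) :=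
  [set conj_class H | H in
    [set H : set (pi1 R x) | subgroup H /\ open (core H : set (pi1 R x))]].

Arguments open_core_classes R {X} x.

Section Coverings.

Definition homeomorphism (S T : topologicalType) (h : S -> T) : Prop :=
  exists k : T -> S,
    [/\ cancel h k, cancel k h, continuous h & continuous k].

Definition homeomorphism_on (S T : topologicalType) (A : set S) (B : set T)
    (h : S -> T) : Prop :=
  exists k : T -> S,
    [/\ set_fun A B h, set_fun B A k, {in A, cancel h k}, {in B, cancel k h} &
        {within A, continuous h} /\ {within B, continuous k}].

Definition evenly_covered (E X : topologicalType) (p : E -> X) (U : set X) :
    Prop :=
  exists S : set (set E),
    [/\ p @^-1` U = \bigcup_(V in S) V, trivIset S id &
        forall V, S V -> open V /\ homeomorphism_on V U p].

Definition covering_map (E X : topologicalType) (p : E -> X) : Prop :=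
  [/\ continuous p, range p = setT &
      forall x, exists U, [/\ open U, U x & evenly_covered p U]].

Definition path_connected (R : realType) (X : topologicalType) (A : set X) :
    Prop :=
  forall x y, A x -> A y ->
    exists p : {path (unit_interval R) from x to y}, range p `<=` A.

Definition locally_path_connected (R : realType) (X : topologicalType) : Prop :=
  forall (x : X) (U : set X), nbhs x U ->
    exists V, [/\ open V, V x, V `<=` U & path_connected R V].

(* Nonemptiness of the total space comes from surjectivity, [connected set0]
   being true. *)
Record connected_covering (X : topologicalType) := ConnectedCovering {
  cover_space : topologicalType;
  cover_map : cover_space -> X;
  cover_mapP : covering_map cover_map;
  cover_connected : connected [set: cover_space]
}.

Definition covering_equiv (X : topologicalType) (c d : connected_covering X) :
    Prop :=
  exists h : cover_space c -> cover_space d,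
    homeomorphism h /\ (forall e, cover_map (h e) = cover_map e).

(* An equivalence class of connected coverings, as the predicate satisfied by
   its members; [set (connected_covering X)] would be a universe
   inconsistency. *)
Record covering_class (X : topologicalType) := CoveringClass {
  members : connected_covering X -> Prop;
  membersP : exists c, members = covering_equiv c
}.

Definition class_of (X : topologicalType) (c : connected_covering X) :
    covering_class X :=
  CoveringClass (ex_intro _ c erefl).

Lemma covering_equiv_refl (X : topologicalType) (c : connected_covering X) :
  covering_equiv c c.
Proof. by exists id; split=> //; exists id; split=> // e; exact: cvg_id. Qed.

Lemma covering_equiv_sym (X : topologicalType) (c d : connected_covering X) :
  covering_equiv c d -> covering_equiv d c.
Proof.
move=> [h [[k [hk kh ch ck]] pE]]; exists k; split; first by exists h.
by move=> e; rewrite -pE kh.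
Qed.

Lemma covering_equiv_trans (X : topologicalType) (b c d : connected_covering X) :
  covering_equiv b c -> covering_equiv c d -> covering_equiv b d.
Proof.
move=> [h [[k [hk kh ch ck]] hE]] [h' [[k' [hk' kh' ch' ck']] hE']].
exists (h' \o h); split; last by move=> e; rewrite /= hE' hE.
exists (k \o k'); split; first exact: can_comp.
- exact: can_comp.
- exact: comp_continuous ch ch'.
- exact: comp_continuous ck' ck.
Qed.

Lemma class_ofP (X : topologicalType) (c d : connected_covering X) :
  class_of c = class_of d <-> covering_equiv c d.
Proof.
split=> [[cd]|cd]; first by rewrite cd; exact: covering_equiv_refl.
have E : covering_equiv c = covering_equiv d.
  apply/funext => e; apply/propext; split; last exact: covering_equiv_trans.
  exact/covering_equiv_trans/covering_equiv_sym.
rewrite /class_of; move: (ex_intro _ c _) (ex_intro _ d _).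
by rewrite E => m m'; rewrite (Prop_irrelevance m m').
Qed.

Lemma class_of_surj (X : topologicalType) (C : covering_class X) :
  exists c, C = class_of c.
Proof.
case: C => m [c mE]; exists c; move: (mE); rewrite mE => mE'.
by congr CoveringClass; exact: Prop_irrelevance.
Qed.

End Coverings.

(* The subgroup p_* pi1(E, e) of pi1(X, x), for p e = x. *)
Definition image_subgroup (R : realType) (E X : topologicalType) (p : E -> X)
    (e : E) (x : X) : set (pi1 R x) :=
  [set loop_class q | q in
    [set q : loop_space R x | exists g : loop_space R e, forall s, q s = p (g s)]].
Arguments image_subgroup R {E X} p e x.

(* Main.v *)
(* If [p : E -> X] is a connected covering, a loop [q] lies in the core of
   [p_* pi1(E, e)] exactly when all lifts of [q], at every point of the fibre, are
   closed.  Endpoints of lifts are locally constant for the compact-open topology,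
   so the core is open; applied along a homotopy, the same fact gives the homotopy
   invariance of lifts.

   Conversely let [H] have open core [N].  Fixing paths [lam y] from [x] to [y], a
   path [d] from [y] to [z] gets a class [tau d = [lam y . d . (lam z)^-1]], and [tau]
   turns concatenation into multiplication.  As [N] is open, [tau d] lies in [N] for
   all sufficiently small loops [d] at [y]; as [N] is normal, it acts trivially on the
   right cosets of [H].  Hence the product of [X] with this coset space, topologised
   so that [(y, f)] is close to [(z, f . tau d)] for short paths [d], is a covering of
   [X], and its subgroup is conjugate to [H]. *)

From HB Require Import structures.
From mathcomp Require Import all_boot all_order all_algebra.
From mathcomp Require Import all_classical all_reals.
From mathcomp Require Import topology.
From mathcomp Require Import normedtype homotopy.
From mathcomp Require Import lra.
From Stdlib Require Setoid Morphisms.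
Require Import Defs.

Set Implicit Arguments.
Unset Strict Implicit.
Unset Printing Implicit Defensive.
Import Order.TTheory GRing.Theory Num.Theory.
Import numFieldNormedType.Exports.
Local Open Scope classical_set_scope.
Local Open Scope ring_scope.

(** * The unit interval *)

Section IntervalTopology.
Context {R : realType}.
Local Notation I := (unit_interval R).

Definition between (a b : R) : set I := [set s | a <= coord s <= b].

Lemma betweenE (a b : I) :
  between (coord a) (coord b) = clamp @` `[coord a, coord b].
Proof.
apply/seteqP; split=> [s sab|_ [r /= rab <-]].
  by exists (coord s); [rewrite /= in_itv|rewrite coordK].
have /andP[ar rb] : coord a <= r <= coord b by move: rab; rewrite in_itv.
have /andP[a0 _] := unit_intervalP a; have /andP[_ b1] := unit_intervalP b.
rewrite /between /= coord_clamp ?ar //.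
by rewrite (le_trans a0 ar) (le_trans rb b1).
Qed.

Lemma between01 : between (coord (zero : I)) (coord (one : I)) = [set: I].
Proof.
apply/seteqP; split=> // s _; rewrite /between /= coord_zero coord_one.
exact: unit_intervalP.
Qed.

Lemma between_connected (a b : I) : connected (between (coord a) (coord b)).
Proof.
rewrite betweenE; apply: connected_continuous_connected.
  exact: segment_connected.
by apply: continuous_subspaceT; exact: clamp_continuous.
Qed.

Lemma unit_interval_compact : compact [set: I].
Proof.
rewrite -between01 betweenE; apply: continuous_compact; last exact: segment_compact.
by apply: continuous_subspaceT; exact: clamp_continuous.
Qed.

Lemma unit_interval_connected : connected [set: I].
Proof. by rewrite -between01; exact: between_connected. Qed.

Lemma between_compact (a b : R) : compact (between a b).
Proof.
have closed_between : closed (between a b).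
  rewrite (_ : between a b = coord @^-1` `[a, b]).
    by apply: preimage_closed; [move=> s _; exact: coord_continuous|exact: interval_closed].
  by apply/seteqP; split=> s; rewrite /between /= in_itv.
exact: (subclosed_compact closed_between unit_interval_compact).
Qed.

Lemma nbhs_interval (t : I) (W : set I) : nbhs t W ->
  exists2 d : R, 0 < d & forall s, `|coord s - coord t| < d -> W s.
Proof.
rewrite -[t in nbhs t]coordK => /clamp_continuous.
rewrite /= => /nbhs_ballP[d /= d0 dW]; exists d => // s sd.
by rewrite -(coordK s); apply: dW; rewrite /ball /= distrC.
Qed.

Lemma coord_nbhs (t : I) (d : R) : 0 < d ->
  nbhs t [set s : I | `|coord s - coord t| < d].
Proof.
move=> d0; apply: (filterS (P := coord @^-1` ball (coord t) d)).
  by move=> s; rewrite /ball /= distrC.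
exact: (coord_continuous (nbhsx_ballx _ _ d0)).
Qed.

(* Connectedness of [0, 1] as an induction principle: the set of [t] such that
   [Q zero s] for all [s <= t] is clopen. *)
Lemma unit_interval_chain (Q : I -> I -> Prop) :
  (forall a b c, coord a <= coord b -> coord b <= coord c ->
     Q a b -> Q b c -> Q a c) ->
  (forall t : I, exists W : set I, nbhs t W /\ forall a b, coord a <= coord b ->
     between (coord a) (coord b) `<=` W -> Q a b) ->
  Q zero one.
Proof.
move=> Qtrans Qloc; pose S := [set t | forall s, coord s <= coord t -> Q zero s].
suff ST : S = [set: I] by have : S one by [rewrite ST]; apply.
have zeroP s : coord (zero : I) <= coord s.
  by rewrite coord_zero; have /andP[] := unit_intervalP s.
have step t u : S t ->
    (forall s, coord t <= coord s -> coord s <= coord u -> Q t s) -> S u.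
  move=> St tu s su; have [st|/ltW ts] := leP (coord s) (coord t); first exact: St.
  by apply: (Qtrans _ t) => //; [exact: St|exact: tu].
(* A ball inside the given neighbourhood is order convex, so any two of its points bound an interval
   on which the local hypothesis applies. *)
have near_step (t : I) : exists2 W : set I, nbhs t W & forall u v s, W u -> W v ->
    coord u <= coord s -> coord s <= coord v -> Q u s /\ Q s v.
  have [W [Wt WQ]] := Qloc t; have [d d0 dW] := nbhs_interval Wt.
  exists [set s | `|coord s - coord t| < d]; first exact: coord_nbhs.
  move=> u v s /= ud vd us sv; split; apply: WQ => // r /andP[sr rv]; apply: dW;
  by move: ud vd; rewrite !ltr_norml => /andP[? ?] /andP[? ?]; apply/andP; split; lra.
apply: unit_interval_connected.
- exists zero => s s0; have -> : s = zero.
    by apply: coord_inj; apply/eqP; rewrite eq_le s0 zeroP.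
  have [W [W0 WQ]] := Qloc zero; apply: WQ => // u /andP[u1 u2].
  have -> : u = zero by apply: coord_inj; apply/eqP; rewrite eq_le u2 u1.
  exact: nbhs_singleton.
(* Openness: a nearby [u] is reached by stepping from [t], which is in [S]. For closedness the roles
   are exchanged: some [u] of [S] close to [t] is the starting point of the step. *)
- exists S; last by rewrite setTI.
  rewrite openE => t St; have [W Wt WQ] := near_step t.
  apply: filterS (Wt) => u Wu; apply: (step t) => // s ts su.
  by apply: (WQ t u s _ _ _ _).1 => //; exact: nbhs_singleton.
- exists S; last by rewrite setTI.
  move=> t clS; have [W Wt WQ] := near_step t.
  have [u [Su Wu]] := clS _ Wt; apply: (step u) => // s us st.
  by apply: (WQ u t s _ _ _ _).1 => //; exact: nbhs_singleton.
Qed.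

End IntervalTopology.

(** * Sheets and connecting paths *)

Section Sheets.
Context {E X : topologicalType}.

(** One sheet over [U] with its local inverse, in pointwise form: [k] is a total function whose
    values matter only on [U]. The last field replaces the disjointness of the sheets: a connected
    set over [U] cannot leave the sheet it meets. *)
Record is_sheet (p : E -> X) (U : set X) (S : set E) (k : X -> E) : Prop :=
  IsSheet {
    sheet_open : open S;
    sheet_sub : forall z, S z -> U (p z);
    section_sheet : forall w, U w -> S (k w);
    sectionK : forall w, U w -> p (k w) = w;
    sheetK : forall z, S z -> k (p z) = z;
    section_cts : forall w, U w -> {for w, continuous k};
    sheet_connected : forall C : set E, connected C -> C `<=` p @^-1` U ->
      (exists2 z, C z & S z) -> C `<=` S }.

Lemma evenly_covered_sheet (p : E -> X) (U : set X) (e : E) :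
  open U -> evenly_covered p U -> U (p e) ->
  exists S k, is_sheet p U S k /\ S e.
Proof.
move=> oU [F [pU trivF sheetF]] Upe.
have : (p @^-1` U) e by []; rewrite pU => -[S FS Se].
have [oS [k [pSU kUS pK kK [_ ck]]]] := sheetF S FS.
exists S, k; split=> //; split=> //.
- by move=> w Uw; apply: kK; exact/mem_set.
- by move=> z Sz; apply: pK; exact/mem_set.
- by move=> w Uw; move: ck; rewrite continuous_open_subspace //; apply; exact/mem_set.
- move=> C cC CU [z Cz Sz].
  have oF : open (\bigcup_(V in F `\ S) V).
    by apply: bigcup_open => V [FV _]; exact: (sheetF V FV).1.
  have disj V z' : F V -> V z' -> S z' -> V = S.
    by move=> FV Vz Sz'; apply: trivF => //; exists z'.
  suff CS : C `&` S = C by rewrite -CS; exact: subIsetr.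
  apply: cC; first by exists z.
  + by exists S.
  + exists (~` \bigcup_(V in F `\ S) V); first exact: open_closedC.
    apply/seteqP; split=> [w [Cw Sw]|w [Cw nw]]; split=> //.
      by move=> [V [FV VS] Vw]; apply: VS; exact: disj FV Vw Sw.
    have : (p @^-1` U) w by exact: CU.
    rewrite pU => -[V FV Vw]; have [<- //|VS] := pselect (V = S).
    by exfalso; apply: nw; exists V.
Qed.

Lemma covering_sheet (p : E -> X) (e : E) : covering_map p ->
  exists U S k, [/\ open U, U (p e), is_sheet p U S k & S e].
Proof.
move=> [_ _ /(_ (p e))[U [oU Ue evU]]].
by have [S [k [sh Se]]] := evenly_covered_sheet oU evU Ue; exists U, S, k.
Qed.

Lemma sheet_inj p U S k z w : is_sheet p U S k -> S z -> S w -> p z = p w -> z = w.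
Proof. by move=> sh Sz Sw pzw; rewrite -(sheetK sh Sz) pzw (sheetK sh). Qed.

End Sheets.

Section ConnectedPaths.
Context {R : realType} {X : topologicalType}.
Local Notation I := (unit_interval R).

Lemma image_connected (S : topologicalType) (g : S -> X) (A : set S) :
  continuous g -> connected A -> connected (g @` A).
Proof.
by move=> cg cA; apply: connected_continuous_connected => //; exact: continuous_subspaceT.
Qed.

Lemma path_connected_connected (A : set X) : path_connected R A -> connected A.
Proof.
move=> pA; have [[a Aa]|A0] := pselect (exists a, A a); last first.
  have -> : A = set0 by apply/seteqP; split=> // a Aa; apply: A0; exists a.
  exact: connected0.
have -> : A = \bigcup_(C in [set C | [/\ connected C, C a & C `<=` A]]) C.
  apply/seteqP; split=> [b Ab|b [C [_ _ CA] /CA //]].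
  have [l lA] := pA a b Aa Ab; exists (range l); last first.
    by exists one; rewrite ?path_one.
  split=> //; last by exists zero; rewrite ?path_zero.
  by apply: image_connected unit_interval_connected; exact: cts_fun.
by apply: bigcup_connected; [exists a => C []|move=> C []].
Qed.

(** The set of points reachable from [x] is clopen, because a path connected neighbourhood lies in
    it as soon as one of its points does. *)
Lemma lpc_connecting_path : connected [set: X] -> locally_path_connected R X ->
  forall x y : X, inhabited {path I from x to y}.
Proof.
move=> cX lpc x y; pose A := [set z | inhabited {path I from x to z}].
suff AT : A = setT by have : A y by [rewrite AT].
have step z w V : path_connected R V -> V z -> V w -> A z -> A w.
  by move=> pV Vz Vw [l]; have [m _] := pV z w Vz Vw; exact: (inhabits (concat l m)).
apply: cX; first by exists x; exact: (inhabits (cst x : {path I from x to x})).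
- exists A; last by rewrite setTI.
  rewrite openE => z Az; have [V [oV Vz _ pV]] := lpc z setT filterT.
  apply: filterS (open_nbhs_nbhs (conj oV Vz)) => w Vw; exact: (step z w V).
- exists A; last by rewrite setTI.
  move=> z clA; have [V [oV Vz _ pV]] := lpc z setT filterT.
  have [w [Aw Vw]] := clA V (open_nbhs_nbhs (conj oV Vz)).
  exact: (step w z V _ _ (nbhs_singleton (open_nbhs_nbhs (conj oV Vz)))).
Qed.

End ConnectedPaths.

(** * Path lifting *)

Section PathLifting.
Context {R : realType} {E X : topologicalType} (p : E -> X).
Hypothesis covp : covering_map p.
Local Notation I := (unit_interval R).

(** Monodromy as a relation between starting point and endpoint. Taking [g] as a bare function lets
    it range over the compact-open space and over the slices of a homotopy. *)
Definition lift_ends (g : I -> X) (e z : E) : Prop :=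
  exists G : {path I from e to z}, forall s, p (G s) = g s.

Lemma covering_nbhs (y : X) : exists U, [/\ open U, U y & evenly_covered p U].
Proof. by case: covp. Qed.

Lemma lift_in_sheet U S k (G : I -> E) (a b : I) :
  is_sheet p U S k -> continuous G -> coord a <= coord b ->
  (forall s, between (coord a) (coord b) s -> U (p (G s))) -> S (G a) -> S (G b).
Proof.
move=> sh cG ab GU Sa.
have CS := sheet_connected sh (image_connected cG (@between_connected R a b)).
apply: CS; last by exists b; rewrite //= /between /= lexx andbT.
  by move=> _ [s sab <-]; exact: GU.
by exists (G a) => //; exists a; rewrite //= /between /= lexx.
Qed.

(** Agreement propagates along [0, 1]: on a short interval both lifts stay in the sheet of their
    common starting value, where [p] is injective. *)
Lemma lift_unique (G1 G2 : I -> E) : continuous G1 -> continuous G2 ->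
  (forall s, p (G1 s) = p (G2 s)) -> G1 zero = G2 zero -> G1 one = G2 one.
Proof.
move=> cG1 cG2 pG.
apply: (unit_interval_chain (Q := fun a b => G1 a = G2 a -> G1 b = G2 b)).
  by move=> a b c _ _ ab bc /ab.
move=> t; have [U [oU Ut evU]] := covering_nbhs (p (G1 t)).
exists (G1 @^-1` (p @^-1` U)); split.
  have [cp _ _] := covp; apply: cG1; apply: cp; exact: open_nbhs_nbhs.
move=> a b ab sub G12.
have Ua : U (p (G1 a)) by apply: sub; rewrite /between /= lexx.
have [S [k [sh Sa]]] := evenly_covered_sheet oU evU Ua.
apply: (sheet_inj sh _ _ (pG b)).
  exact: lift_in_sheet sh cG1 ab _ Sa.
apply: (lift_in_sheet sh cG2 ab); last by rewrite -G12.
by move=> s sab; rewrite -pG; exact: sub.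
Qed.

Lemma lift_ends_unique (g : I -> X) e z z' :
  lift_ends g e z -> lift_ends g e z' -> z = z'.
Proof.
move=> [G pG] [G' pG']; rewrite -(@path_one _ _ _ _ G) -(@path_one _ _ _ _ G').
apply: lift_unique; try exact: cts_fun; first by move=> s; rewrite pG pG'.
by rewrite !path_zero.
Qed.

Lemma lift_exists (g : I -> X) (e : E) :
  continuous g -> p e = g zero -> exists z, lift_ends g e z.
Proof.
move=> cg.
(* Quantifying over every starting point makes [Q] composable: the second lift starts where the
   first one ends. [G] is defined on all of [0, 1] but has to lift [g] only on [a, b]. *)
pose Q a b := forall e, p e = g a -> exists G : I -> E,
  [/\ continuous G, G a = e &
      forall s, between (coord a) (coord b) s -> p (G s) = g s].
suff Q01 : Q zero one.
  move=> /Q01[G [cG G0 pG]]; exists (G one), (mk_path cG G0 erefl) => s.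
  by apply: pG; rewrite between01.
apply: unit_interval_chain.
  move=> a b c ab bc Qab Qbc e' /Qab[G1 [cG1 G1a pG1]].
  have [G2 [cG2 G2b pG2]] : exists G : I -> E, [/\ continuous G, G b = G1 b &
      forall s, between (coord b) (coord c) s -> p (G s) = g s].
    by apply: Qbc; apply: pG1; rewrite /between /= lexx andbT.
  exists (fun s => if coord s <= coord b then G1 s else G2 s); split.
  - apply: paste_continuous => //; first exact: coord_continuous.
    by move=> s /coord_inj ->.
  - by rewrite ab.
  - move=> s /andP[sa sc]; case: ifPn => [sb|]; first by apply: pG1; rewrite /between /= sa.
    by rewrite -ltNge => /ltW sb; apply: pG2; rewrite /between /= sb.
move=> t; have [U [oU Ut evU]] := covering_nbhs (g t).
exists (g @^-1` U); split; first by apply: cg; exact: open_nbhs_nbhs.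
move=> a b ab sub e' pe'.
have Ue' : U (p e') by rewrite pe'; apply: sub; rewrite /between /= lexx.
have [S [k [sh Se']]] := evenly_covered_sheet oU evU Ue'.
(* Only [a, b] is known to be sent into [U], where [k] is continuous, so the parameter is first
   retracted onto [a, b]. *)
pose clip (s : I) : I := clamp (Num.max (coord a) (Num.min (coord s) (coord b))).
have clipE s : between (coord a) (coord b) s -> clip s = s.
  by move=> /andP[sa sb]; rewrite /clip min_l // max_r // coordK.
have clip_between s : between (coord a) (coord b) (clip s).
  have /andP[a0 _] := unit_intervalP a; have /andP[_ b1] := unit_intervalP b.
  have h : coord a <= Num.max (coord a) (Num.min (coord s) (coord b)) <= coord b.
    by rewrite le_max lexx ge_max ab ge_min lexx orbT.
  have /andP[h1 h2] := h.
  by rewrite /between /= /clip coord_clamp // (le_trans a0 h1) (le_trans h2 b1).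
have cclip : continuous clip.
  apply: comp_continuous clamp_continuous.
  rewrite (_ : (fun s => _) = cst (coord a) \max (coord \min cst (coord b))) // => s.
  apply: continuous_max; first exact: cst_continuous.
  apply: (@continuous_min R I coord (cst (coord b))); first exact: coord_continuous.
  exact: cst_continuous.
exists (fun s => k (g (clip s))); split.
- move=> s; apply: (@continuous_comp _ _ _ (fun s => g (clip s)) k).
    exact: comp_continuous cclip cg s.
  by apply: (section_cts sh); exact: sub.
- rewrite clipE; last by rewrite /between /= lexx.
  by rewrite -pe' (sheetK sh).
- by move=> s sab; rewrite clipE // (sectionK sh) //; exact: sub.
Qed.

Hypothesis lpcX : locally_path_connected R X.

(** Lifts of [g] and of a nearby [h] that start together run through the same sheets on finitely
    many short intervals, so they end in the same sheet; since [g] and [h] have the same endpoint,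
    so do the lifts. *)
Lemma lift_ends_nbhs (g : I -> X) : continuous g ->
  \forall h \near (g : {compact-open, I -> X}), continuous (h : I -> X) ->
    h zero = g zero -> h one = g one ->
    forall e z, lift_ends g e z -> lift_ends h e z.
Proof.
move=> cg.
(* Points of [E] in a common connected set over an evenly covered [V] lie in the
   same sheet over [V]. *)
pose close V z z' := exists C : set E, [/\ connected C, C `<=` p @^-1` V, C z & C z'].
(* The neighbourhood at [b] is prescribed and the one at [a] is found, so that steps compose
   backwards from [one]; each step costs one neighbourhood of [g] in the compact-open topology. *)
pose Q (a b : I) := forall V, nbhs (g b) V -> exists2 U, nbhs (g a) U &
  \forall h \near (g : {compact-open, I -> X}), forall G H : I -> E,
    continuous G -> continuous H -> (forall s, p (G s) = g s) ->
    (forall s, p (H s) = h s) ->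
    close U (G a) (H a) -> close V (G b) (H b).
have Q01 : Q zero one.
  apply: unit_interval_chain.
    move=> a b c _ _ Qab Qbc V /Qbc[U /Qab[W Wa nearab] nearbc].
    exists W => //; apply: filterS2 nearab nearbc => h hab hbc G H cG cH pG pH.
    by move/(hab G H cG cH pG pH)/(hbc G H cG cH pG pH).
  move=> t; have [U [oU Ut evU]] := covering_nbhs (g t).
  exists (g @^-1` U); split; first by apply: cg; exact: open_nbhs_nbhs.
  move=> a b ab sub V Vb.
  have Ub : U (g b) by apply: sub; rewrite /between /= lexx andbT.
  have UVb : nbhs (g b) (U `&` V) by apply: filterI => //; exact: open_nbhs_nbhs.
  have [V' [oV' V'b V'UV pV']] := lpcX UVb.
  exists U; first by apply: open_nbhs_nbhs; split=> //; apply: sub; rewrite /between /= lexx.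
  (* Two subbasic conditions on [h]: it sends [a, b] into [U], which keeps its lift in the sheet,
     and [b] into [V'], whose connected image under [k] joins the two lifts at [b]. *)
  have n1 : nbhs (g : {compact-open, I -> X})
      [set h | h @` between (coord a) (coord b) `<=` U].
    apply: open_nbhs_nbhs; split; first exact: compact_open_open (@between_compact R _ _) oU.
    by move=> _ [s sab <-]; exact: sub.
  have n2 : nbhs (g : {compact-open, I -> X}) [set h | h @` [set b] `<=` V'].
    apply: open_nbhs_nbhs; split; first exact: compact_open_open (@compact_set1 _ b) oV'.
    by move=> _ [s -> <-].
  apply: filterS2 n1 n2 => h hU hV G H cG cH pG pH [C [cC CU Ca Ca']].
  have [S [k [sh Sa]]] := evenly_covered_sheet oU evU (CU _ Ca).
  have Sa' : S (H a) by apply: (sheet_connected sh cC CU) => //; exists (G a).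
  have Sb : S (G b).
    by apply: (lift_in_sheet sh cG ab) => // s sab; rewrite pG; exact: sub.
  have Sb' : S (H b).
    by apply: (lift_in_sheet sh cH ab) => // s sab; rewrite pH; apply: hU; exists s.
  have V'b' : V' (h b) by apply: hV; exists b.
  exists (k @` V'); split.
  - apply: connected_continuous_connected; first exact: path_connected_connected pV'.
    apply: continuous_in_subspaceT => w /set_mem V'w.
    by apply: (section_cts sh); have [] := V'UV w V'w.
  - by move=> _ [w V'w <-]; have [Uw Vw] := V'UV w V'w; rewrite /= (sectionK sh Uw).
  - by exists (g b) => //; rewrite -pG (sheetK sh).
  - by exists (h b) => //; rewrite -pH (sheetK sh).
have [V [oV V1 evV]] := covering_nbhs (g one).
have [U U0 near01] := Q01 V (open_nbhs_nbhs (conj oV V1)).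
apply: filterS near01 => h hGH ch h0 h1 e z [G pG].
have pe : p e = h zero by rewrite h0 -pG path_zero.
have [z' [H pH]] := lift_exists ch pe.
have [|C [cC CV C1 C1']] := hGH G H (@cts_fun _ _ G) (@cts_fun _ _ H) pG pH.
  exists [set e]; rewrite !path_zero; split=> //; first exact: connected1.
  by move=> _ ->; rewrite /= -(@path_zero _ _ _ _ G) pG; exact: nbhs_singleton.
have [S [k [sh S1]]] := evenly_covered_sheet oV evV (CV _ C1).
have S1' : S (H one) by apply: (sheet_connected sh cC CV) => //; exists (G one).
have zz' : z = z'.
  rewrite -(@path_one _ _ _ _ G) -(@path_one _ _ _ _ H); apply: (sheet_inj sh) => //.
  by rewrite pG pH h1.
by rewrite zz'; exists H.
Qed.

Lemma lift_ends_homotopic (a b : X) (g h : {path I from a to b}) e z :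
  path_homotopic g h -> lift_ends g e z -> lift_ends h e z.
Proof.
move=> [H [cH H0 H1 He]] gez.
(* With the deformation parameter first, currying turns the homotopy into a continuous path in the
   compact-open space, along which the endpoint of the lift is locally constant. *)
pose f (u : I * I) := H (u.2, u.1).
have cf : continuous f.
  by apply: comp_continuous cH; apply: pair_continuous; [exact: snd_cts|exact: fst_cts].
have [ccurry cslice] := continuous_curry cf.
have f0 t t' : curry f t zero = curry f t' zero by rewrite /curry /f (He t).1 (He t').1.
have f1 t t' : curry f t one = curry f t' one by rewrite /curry /f (He t).2 (He t').2.
suff : lift_ends (curry f zero) e z -> lift_ends (curry f one) e z.
  have -> : curry f zero = g by apply/funext => s; exact: H0.
  have -> : curry f one = h by apply/funext => s; exact: H1.
  exact.
apply: (unit_interval_chain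
  (Q := fun t t' => lift_ends (curry f t) e z -> lift_ends (curry f t') e z)).
  by move=> t1 t2 t3 _ _ h12 h23 /h12/h23.
move=> t; exists (curry f @^-1` [set k : {compact-open, I -> X} |
  continuous (k : I -> X) -> k zero = curry f t zero -> k one = curry f t one ->
    forall e z, lift_ends (curry f t) e z -> lift_ends k e z]); split.
  by apply: ccurry; exact: lift_ends_nbhs.
move=> t1 t2 t12 sub lift1.
have pe : p e = curry f t zero.
  by case: lift1 => [G pG]; rewrite (f0 t t1) -pG path_zero.
(* Local constancy is known only around the slice at [t]. Both nearby slices are therefore compared
   with its lift, and uniqueness identifies [z'] with [z]. *)
have [z' liftt] := lift_exists (cslice t) pe.
have near_t t' : between (coord t1) (coord t2) t' -> lift_ends (curry f t') e z'.
  by move/sub; apply.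
rewrite (lift_ends_unique lift1 (near_t t1 _)); last by rewrite /between /= lexx.
by apply: near_t; rewrite /between /= lexx andbT.
Qed.

Lemma lift_ends_concat (a b c : X) (g : {path I from a to b})
    (h : {path I from b to c}) e z w :
  lift_ends g e z -> lift_ends h z w -> lift_ends (concat g h) e w.
Proof.
move=> [G pG] [H pH]; exists (concat G H) => s.
by rewrite !concatE; case: ifP.
Qed.

Lemma lift_ends_reverse (a b : X) (g : {path I from a to b}) e z :
  lift_ends g e z -> lift_ends (reverse g) z e.
Proof. by move=> [G pG]; exists (reverse G) => s; rewrite !reverseE. Qed.

Lemma lift_path (a b : X) (g : {path I from a to b}) (e : E) :
  p e = a -> exists2 z, lift_ends g e z & p z = b.
Proof.
move=> pe; have [|z [G pG]] := lift_exists (g := g) (e := e) (@cts_fun _ _ g).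
  by rewrite path_zero.
exists z; first by exists G.
by rewrite -(@path_one _ _ _ _ G) pG path_one.
Qed.

Lemma lift_ends_stop (g : I -> X) e z : lift_ends g e z -> p z = g one.
Proof. by move=> [G pG]; rewrite -pG path_one. Qed.

End PathLifting.

(** * Subgroups of coverings and the lifting criterion *)

Section Pushforward.
Context {R : realType} {E X : topologicalType} (p : E -> X).
Local Notation I := (unit_interval R).

Definition push_path (cp : continuous p) (y z : E) (a b : X) (ya : p y = a)
    (zb : p z = b) (G : {path I from y to z}) : {path I from a to b} :=
  mk_path (comp_continuous (@cts_fun _ _ G) cp)
    (etrans (congr1 p path_zero) ya) (etrans (congr1 p path_one) zb).

Lemma lift_ends_push (cp : continuous p) (y z : E) (a b : X) (ya : p y = a)
    (zb : p z = b) (G : {path I from y to z}) :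
  lift_ends p (push_path cp ya zb G) y z.
Proof. by exists G. Qed.

End Pushforward.

Lemma pi1_mulgE (R : realType) (X : topologicalType) (x : X) (q r : loop_space R x) :
  (loop_class q * loop_class r)%g = loop_class (concat q r).
Proof. exact: pi1_mulE. Qed.

Lemma pi1_invgE (R : realType) (X : topologicalType) (x : X) (q : loop_space R x) :
  ((loop_class q)^-1)%g = loop_class (reverse q).
Proof. exact: pi1_invE. Qed.

Lemma pi1_1gE (R : realType) (X : topologicalType) (x : X) :
  1%g = loop_class (cst x : loop_space R x).
Proof. by []. Qed.

Lemma conj_setE (G : groupType) (H : set G) (g a : G) :
  conj_set H g a = H (a ^ g^-1)%g.
Proof.
apply/propext; split=> [[h Hh <-]|Ha]; first by rewrite conjgK.
by exists (a ^ g^-1)%g; rewrite // conjgKV.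
Qed.

Lemma conj_set1 (G : groupType) (H : set G) : conj_set H 1%g = H.
Proof. by apply/funext => a; rewrite conj_setE invg1 conjg1. Qed.

Lemma conj_setM (G : groupType) (H : set G) (g k : G) :
  conj_set (conj_set H g) k = conj_set H (g * k)%g.
Proof. by apply/funext => a; rewrite !conj_setE invgM conjgM. Qed.

Lemma conj_class_conj (G : groupType) (H : set G) (g : G) :
  conj_class (conj_set H g) = conj_class H.
Proof.
apply/seteqP; split=> _ [k _ <-].
  by exists (g * k)%g; rewrite // conj_setM.
by exists (g^-1 * k)%g; rewrite // conj_setM mulgA mulgV mul1g.
Qed.

Lemma conj_class_eq (G : groupType) (H K : set G) :
  conj_class H = conj_class K -> exists g, K = conj_set H g.
Proof.
move=> HK; have : conj_class H K by rewrite HK; exists 1%g; rewrite // conj_set1.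
by move=> [g _ <-]; exists g.
Qed.

Lemma covering_lpc (R : realType) (E X : topologicalType) (p : E -> X) :
  covering_map p -> locally_path_connected R X -> locally_path_connected R E.
Proof.
move=> covp lpcX e O Oe; have [cp _ _] := covp.
have [U [S [k [oU Ue sh Se]]]] := covering_sheet e covp.
have UkO : nbhs (p e) (U `&` k @^-1` (O `&` S)).
  apply: filterI; first exact: open_nbhs_nbhs.
  apply: (section_cts sh) => //; rewrite (sheetK sh Se).
  by apply: filterI => //; apply: open_nbhs_nbhs; split=> //; exact: sheet_open sh.
have [V [oV Ve VUO pV]] := lpcX _ _ UkO.
(* This is the part of the sheet over [V]; [k] carries paths in [V] back into it. *)
exists (S `&` p @^-1` V); split=> //.
- apply: openI; first exact: sheet_open sh.
  by apply: open_comp => // z _; exact: cp.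
- by move=> z [Sz /VUO[_ [+ _]]]; rewrite (sheetK sh Sz).
- move=> y z [Sy Vy] [Sz Vz]; have [l lV] := pV _ _ Vy Vz.
  have lU s : U (l s) by have [] := VUO (l s) (lV _ (imageT l s)).
  have ckl : continuous (fun s => k (l s)).
    move=> s; apply: (@continuous_comp _ _ _ l k); first exact: cts_fun.
    exact: (section_cts sh).
  have kl0 : k (l zero) = y by rewrite path_zero (sheetK sh).
  have kl1 : k (l one) = z by rewrite path_one (sheetK sh).
  exists (mk_path ckl kl0 kl1) => _ [s _ <-]; split; first exact: (section_sheet sh).
  by rewrite /= /mk_path (sectionK sh) //; exact: lV (imageT l s).
Qed.

(** * The subgroup of a covering, its conjugates and its core *)

Section ImageSubgroup.
Context {R : realType} {E X : topologicalType} (p : E -> X) (x : X).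
Hypothesis covp : covering_map p.
Hypothesis lpcX : locally_path_connected R X.
Local Notation I := (unit_interval R).
Local Notation Im e := (image_subgroup R p e x).

(** Membership only provides some representative with a closed lift; homotopy invariance of
    endpoints passes this on to [q] itself. *)
Lemma image_subgroupP (e : E) (q : loop_space R x) :
  Im e (loop_class q) <-> lift_ends p q e e.
Proof.
split=> [[r [G rG] /loop_classP rq]|[G pG]]; last by exists q => //; exists G.
by apply: (lift_ends_homotopic covp lpcX rq); exists G.
Qed.

Lemma image_subgroup_subgroup (e : E) : p e = x -> subgroup (Im e).
Proof.
move=> pe; split.
  by apply/mem_set; rewrite pi1_1gE; apply/image_subgroupP; exists (cst e).
move=> a b /set_mem; rewrite -(loop_class_repr a) => /image_subgroupP la.
move=> /set_mem; rewrite -(loop_class_repr b) => /image_subgroupP lb.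
apply/mem_set; rewrite pi1_invgE pi1_mulgE; apply/image_subgroupP.
by apply: lift_ends_concat la _; exact: lift_ends_reverse.
Qed.

(** A loop [a] lifts to a closed path at [e'] exactly when [q . a . q^-1] does at [e]: go along the
    lift of [q], around, and back. *)
Lemma image_subgroup_conj (e e' : E) (q : loop_space R x) :
  lift_ends p q e e' -> Im e' = conj_set (Im e) (loop_class q).
Proof.
move=> lq; apply/seteqP; split=> a.
  rewrite -(loop_class_repr a) => /image_subgroupP la; rewrite conj_setE.
  rewrite conjgE invgK pi1_invgE [X in (_ * X)%g]pi1_mulgE pi1_mulgE; apply/image_subgroupP.
  apply: (lift_ends_concat lq); apply: (lift_ends_concat la).
  exact: lift_ends_reverse lq.
move=> [h + <-]; rewrite -(loop_class_repr h) => /image_subgroupP lh.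
rewrite conjgE pi1_invgE [X in (_ * X)%g]pi1_mulgE pi1_mulgE; apply/image_subgroupP.
apply: lift_ends_concat (lift_ends_reverse lq) _.
exact: lift_ends_concat lh lq.
Qed.

Lemma image_subgroup_conjE (e : E) (g : pi1 R x) : p e = x ->
  exists2 e', p e' = x & conj_set (Im e) g = Im e'.
Proof.
move=> pe; rewrite -(loop_class_repr g).
have [e' le' pe'] := lift_path covp (repr g : loop_space R x) pe.
by exists e'; rewrite // (image_subgroup_conj le').
Qed.

Hypothesis connE : connected [set: E].

Lemma image_subgroup_conj_fiber (e e' : E) : p e = x -> p e' = x ->
  exists g, Im e' = conj_set (Im e) g.
Proof.
move=> pe pe'; have [cp _ _] := covp.
have [G] := lpc_connecting_path connE (covering_lpc covp lpcX) e e'.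
exists (loop_class (push_path cp pe pe' G)).
by apply: image_subgroup_conj; exact: lift_ends_push.
Qed.

(** The conjugates of [Im e] are exactly the subgroups [Im e'] for [e'] in the fibre: lifting a loop
    yields [e'] from the conjugating element, and a path in [E] yields the element from [e']. *)
Lemma core_image_subgroupP (e : E) (q : loop_space R x) : p e = x ->
  core (Im e) (loop_class q) <-> forall e', p e' = x -> lift_ends p q e' e'.
Proof.
move=> pe; split=> [coreq e' pe'|lq g _].
  have [g Hg] := image_subgroup_conj_fiber pe pe'.
  by apply/image_subgroupP; rewrite Hg; exact: coreq.
by have [e' pe' ->] := image_subgroup_conjE g pe; apply/image_subgroupP; exact: lq.
Qed.

Lemma open_core_image_subgroup (e : E) : p e = x ->
  open (core (Im e) : set (pi1 R x)).
Proof.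
move=> pe; rewrite open_pi1E openE => q /= /(core_image_subgroupP _ pe) lq.
have cval : continuous (fun r : loop_space R x => (r : I -> X) : {compact-open, I -> X}).
  exact: initial_continuous.
have near_q : nbhs q (_ @^-1` _) := cval q _ (lift_ends_nbhs covp lpcX (@cts_fun _ _ q)).
apply: filterS near_q => r /= near_r; apply/(core_image_subgroupP _ pe) => e' pe'.
by apply: near_r; rewrite ?path_zero ?path_one //; [exact: cts_fun|exact: lq].
Qed.

End ImageSubgroup.

(** * The lifting criterion *)

Section LiftingCriterion.
Context {R : realType} {E F X : topologicalType} (p : E -> X) (r : F -> X) (x : X).
Hypotheses (covp : covering_map p) (covr : covering_map r).
Hypothesis lpcX : locally_path_connected R X.
Hypothesis connE : connected [set: E].
Local Notation I := (unit_interval R).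

Lemma lifting_criterion (e : E) (f : F) : p e = x -> r f = x ->
  image_subgroup R p e x `<=` image_subgroup R r f x ->
  exists h : E -> F, [/\ continuous h, forall z, r (h z) = p z & h e = f].
Proof.
move=> pe rf sub; have [cp _ _] := covp.
have lpcE := covering_lpc covp lpcX.
have pathE := lpc_connecting_path connE lpcE.
(* The graph of the map sought: project a path from [e] to [z] down to [X] and lift it to [F] from
   [f]. *)
pose T z w := exists G : {path I from e to z}, lift_ends r (fun s => p (G s)) f w.
have Tuniq z w w' : T z w -> T z w' -> w = w'.
  move=> [G lG] [G' lG'].
  pose g : {path I from x to p z} := push_path cp pe erefl G.
  pose g' : {path I from x to p z} := push_path cp pe erefl G'.
  (* Independence of the path: the loop [g . g'^-1] lifts to a closed path at [e], hence by [sub] at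
     [f]. So the lift of [g'^-1] from [w] ends at [f], and its reverse is the lift of [g'] from [f],
     which ends at [w]. *)
  have loop_e : lift_ends p (concat g (reverse g')) e e.
    by apply: (@lift_ends_concat _ _ _ _ _ _ _ _ _ _ z);
      [|apply: lift_ends_reverse]; exact: lift_ends_push.
  have loop_f : lift_ends r (concat g (reverse g')) f f.
    by apply/(image_subgroupP covr lpcX)/sub/(image_subgroupP covp lpcX).
  have [|v lv _] := lift_path covr (reverse g') (e := w).
    by rewrite (lift_ends_stop lG) path_one.
  have vf : v = f.
    by apply: (lift_ends_unique covr _ loop_f); exact: lift_ends_concat lv.
  have := lift_ends_reverse lv; rewrite vf reverseK => lw.
  exact: (lift_ends_unique covr lw).
have Tex z : exists w, T z w.
  have [G] := pathE e z.
  have [||w lw] := lift_exists covr (g := fun s => p (G s)) (e := f).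
  - exact: comp_continuous (@cts_fun _ _ G) cp.
  - by rewrite path_zero pe.
  by exists w, G.
have [h hT] := choice Tex.
have rh z : r (h z) = p z.
  by have [G lG] := hT z; rewrite (lift_ends_stop lG) path_one.
exists h; split=> //; last first.
  apply: Tuniq (hT e) _; exists (cst e), (cst f) => s.
  by rewrite /= rf.
move=> z0 O Oz0.
have [U [S [k [oU Uz0 sh Sz0]]]] := covering_sheet (h z0) covr.
have UkO : nbhs (p z0) (U `&` k @^-1` O).
  rewrite rh in Uz0; apply: filterI; first exact: open_nbhs_nbhs.
  by apply: (section_cts sh) => //; rewrite -rh (sheetK sh Sz0).
have [M [oM Mz0 MUO pM]] := lpcE z0 _ (cp _ _ UkO).
apply: (filterS _ (open_nbhs_nbhs (conj oM Mz0))) => z Mz.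
have [G0 lG0] := hT z0; have [G GM] := pM _ _ Mz0 Mz.
have GU s : U (p (G s)) by have [] := MUO (G s) (GM _ (imageT G s)).
have [_ kO] := MUO z Mz.
(* Near [z0] the map is [k] after [p]: prolonging the path to [z0] by [G] inside [M] prolongs its
   lift by the image of [G] in the sheet. *)
suff hz : h z = k (p z) by rewrite /= hz.
apply: (Tuniq z) (hT z) _; exists (concat G0 G).
have ck : continuous (fun s => k (p (G s))).
  move=> s; apply: (@continuous_comp _ _ _ (fun s => p (G s)) k).
    exact: (comp_continuous (@cts_fun _ _ G) cp).
  exact: (section_cts sh).
have k0 : k (p (G zero)) = h z0 by rewrite path_zero -rh (sheetK sh).
have k1 : k (p (G one)) = k (p z) by rewrite path_one.
have lG : lift_ends r (push_path cp erefl erefl G) (h z0) (k (p z)).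
  by exists (mk_path ck k0 k1) => s; rewrite /= /mk_path (sectionK sh).
have [K rK] := lift_ends_concat (g := push_path cp erefl erefl G0) lG0 lG.
by exists K => s; rewrite rK !concatE; case: ifP.
Qed.

End LiftingCriterion.

(** For a path [G] from [e], both [h \o G] and [G] lift the same path of [X] from the same point, so
    they end together. *)
Lemma lift_of_identity (R : realType) (E X : topologicalType) (p : E -> X)
    (e : E) (h : E -> E) :
  covering_map p -> locally_path_connected R X -> connected [set: E] ->
  continuous h -> (forall z, p (h z) = p z) -> h e = e -> forall z, h z = z.
Proof.
move=> covp lpcX connE ch ph he z.
have [G] := lpc_connecting_path connE (covering_lpc covp lpcX) e z.
rewrite -(@path_one _ _ _ _ G).
apply: (lift_unique covp (G1 := h \o G)) => //.
- exact: comp_continuous (@cts_fun _ _ G) ch.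
- exact: cts_fun.
- by move=> s; rewrite /= ph.
- by rewrite /= path_zero.
Qed.

(** The lifting criterion applies in both directions, and the two composites are lifts of the
    projections that fix a base point, hence identities. *)
Lemma covering_equiv_image_subgroup (R : realType) (X : topologicalType) (x : X)
    (c d : connected_covering X) (e : cover_space c) (f : cover_space d) :
  locally_path_connected R X -> cover_map e = x -> cover_map f = x ->
  image_subgroup R (@cover_map X c) e x = image_subgroup R (@cover_map X d) f x ->
  covering_equiv c d.
Proof.
move=> lpcX ce df cd.
have covc := cover_mapP c; have covd := cover_mapP d.
have connc := @cover_connected _ c; have connd := @cover_connected _ d.
have [|h [ch hE he]] := lifting_criterion covc covd lpcX connc ce df.
  by rewrite cd.
have [|k [ck kE kf]] := lifting_criterion covd covc lpcX connd df ce.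
  by rewrite cd.
exists h; split=> //; exists k; split=> //.
- apply: (lift_of_identity (e := e) (h := k \o h) covc lpcX connc).
  + exact: comp_continuous ch ck.
  + by move=> z; rewrite /= kE hE.
  + by rewrite /= he.
- apply: (lift_of_identity (e := f) (h := h \o k) covd lpcX connd).
  + exact: comp_continuous ck ch.
  + by move=> z; rewrite /= hE kE.
  + by rewrite /= kf.
Qed.

Lemma image_subgroup_covering_equiv (R : realType) (X : topologicalType) (x : X)
    (c d : connected_covering X) (h : cover_space c -> cover_space d)
    (e : cover_space c) :
  continuous h -> (forall z, cover_map (h z) = cover_map z) ->
  image_subgroup R (@cover_map X c) e x `<=` image_subgroup R (@cover_map X d) (h e) x.
Proof.
move=> ch hE _ [q [G qG] <-]; exists q => //.
by exists (push_path ch erefl erefl G) => s; rewrite qG -hE.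
Qed.

(** * Transport of paths to the fundamental group *)

Section PathGroupoid.
Context {R : realType} {X : topologicalType}.
Local Notation I := (unit_interval R).

(** Together with [concat_proper], this lets [rewrite] compute with paths up to homotopy. *)
#[local] Instance path_homotopic_equivalence (x y : X) :
  RelationClasses.Equivalence (@path_homotopic R X x y).
Proof.
split; [exact: path_homotopic_refl|exact: path_homotopic_sym|].
exact: path_homotopic_trans.
Qed.

#[local] Instance concat_proper (x y z : X) :
  Morphisms.Proper
    (Morphisms.respectful (@path_homotopic R X x y)
       (Morphisms.respectful (@path_homotopic R X y z) (@path_homotopic R X x z)))
    (@concat R X x y z).
Proof. by move=> p p' pp' q q' qq'; exact: concat_homotopic. Qed.

Lemma concatKp_homotopic (x y z : X) (p : {path I from x to y}) (q : {path I from x to z}) :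
  path_homotopic (concat p (concat (reverse p) q)) q.
Proof. by rewrite concatA_homotopic concatpV_homotopic concat1p_homotopic; reflexivity. Qed.

Lemma concatVKp_homotopic (x y z : X) (p : {path I from x to y}) (q : {path I from y to z}) :
  path_homotopic (concat (reverse p) (concat p q)) q.
Proof. by rewrite concatA_homotopic concatVp_homotopic concat1p_homotopic; reflexivity. Qed.

Lemma range_zero (x y : X) (p : {path I from x to y}) U : range p `<=` U -> U x.
Proof. by rewrite -{2}(@path_zero _ _ _ _ p); apply; exact: imageT. Qed.

Lemma range_one (x y : X) (p : {path I from x to y}) U : range p `<=` U -> U y.
Proof. by rewrite -{2}(@path_one _ _ _ _ p); apply; exact: imageT. Qed.

Lemma range_concat (x y z : X) (p : {path I from x to y}) (q : {path I from y to z}) U :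
  range p `<=` U -> range q `<=` U -> range (concat p q) `<=` U.
Proof.
by move=> pU qU _ [s _ <-]; rewrite concatE; case: ifP => _;
  [apply: pU|apply: qU]; exact: imageT.
Qed.

Lemma range_reverse (x y : X) (p : {path I from x to y}) U :
  range p `<=` U -> range (reverse p) `<=` U.
Proof. by move=> pU _ [s _ <-]; rewrite reverseE; apply: pU; exact: imageT. Qed.

Lemma segment_path_cts (a b : I) :
  continuous (fun s : I => clamp ((coord b - coord a) * coord s + coord a) : I).
Proof.
apply: comp_continuous clamp_continuous.
by apply: affine_continuous; exact: coord_continuous.
Qed.

Lemma segment_path0 (a b : I) :
  clamp ((coord b - coord a) * coord (zero : I) + coord a) = a.
Proof. by rewrite coord_zero mulr0 add0r coordK. Qed.

Lemma segment_path1 (a b : I) :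
  clamp ((coord b - coord a) * coord (one : I) + coord a) = b.
Proof. by rewrite coord_one mulr1 subrK coordK. Qed.

Definition segment_path (a b : I) : {path I from a to b} :=
  mk_path (@segment_path_cts a b) (segment_path0 a b) (segment_path1 a b).

Lemma segment_path_between (a b s : I) : coord a <= coord b ->
  between (coord a) (coord b) (segment_path a b s).
Proof.
move=> ab; have /andP[s0 s1] := unit_intervalP s.
have /andP[a0 _] := unit_intervalP a; have /andP[_ b1] := unit_intervalP b.
have h0 : 0 <= (coord b - coord a) * coord s by rewrite mulr_ge0 // subr_ge0.
have h1 : (coord b - coord a) * coord s <= coord b - coord a.
  by rewrite ler_piMr // subr_ge0.
by rewrite /between /= /mk_path coord_clamp; apply/andP; split; lra.
Qed.

Section Restriction.
Variables (g : I -> X) (cg : continuous g).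

Definition restrict_path (a b : I) : {path I from g a to g b} :=
  push_path cg erefl erefl (segment_path a b).

(** Both sides are [g] after a path from [a] to [c] in [0, 1], and two such paths are joined by a
    straight-line homotopy. *)
Lemma restrict_path_concat (a b c : I) :
  path_homotopic (concat (restrict_path a b) (restrict_path b c))
                 (restrict_path a c).
Proof.
apply: (reparam_homotopic (p := mk_path cg erefl erefl)
  (phi := concat (segment_path a b) (segment_path b c))
  (psi := segment_path a c)).
- exact: cts_fun.
- exact: cts_fun.
- by rewrite !path_zero.
- by rewrite !path_one.
- by move=> s; rewrite !concatE; case: ifP.
- by [].
Qed.

Lemma restrict_path01 s : restrict_path zero one s = g s.
Proof.
rewrite /restrict_path /push_path /= /mk_path.
by rewrite coord_zero coord_one addr0 subr0 mul1r coordK.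
Qed.

End Restriction.

Section Transport.
Variables (x : X) (lam : forall y, {path I from x to y}).

Definition transport (y z : X) (d : {path I from y to z}) : pi1 R x :=
  loop_class (concat (concat (lam y) d) (reverse (lam z))).

Lemma transport_homotopic (y z : X) (d d' : {path I from y to z}) :
  path_homotopic d d' -> transport d = transport d'.
Proof. by move=> dd'; apply/loop_classP; rewrite dd'; reflexivity. Qed.

(** Compares paths whose types differ because their endpoints are only provably equal. *)
Lemma transport_eq (y z y' z' : X) (d : {path I from y to z})
    (d' : {path I from y' to z'}) :
  y = y' -> z = z' -> d =1 d' -> transport d = transport d'.
Proof. by move=> yy' zz'; subst y' z' => /path_eqP ->. Qed.

Lemma transport_concat (y z w : X) (d : {path I from y to z}) (d' : {path I from z to w}) :
  transport (concat d d') = (transport d * transport d')%g.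
Proof.
rewrite pi1_mulgE; apply/loop_classP.
rewrite -(concatA_homotopic (concat (lam y) d)).
rewrite (concatA_homotopic (reverse (lam z))) concatVKp_homotopic.
rewrite (concatA_homotopic (concat (lam y) d)) (concatA_homotopic (lam y)).
reflexivity.
Qed.

Lemma transport_cst (y : X) : transport (cst y : {path I from y to y}) = 1%g.
Proof.
apply/loop_classP.
by rewrite concatp1_homotopic concatpV_homotopic; reflexivity.
Qed.

Lemma transport_reverse (y z : X) (d : {path I from y to z}) :
  transport (reverse d) = ((transport d)^-1)%g.
Proof.
apply: (mulgI (transport d)); rewrite mulgV -transport_concat -(transport_cst y).
exact/transport_homotopic/concatpV_homotopic.
Qed.

Lemma transport_surj (y z : X) (a : pi1 R x) :
  exists d : {path I from y to z}, transport d = a.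
Proof.
exists (concat (concat (reverse (lam y)) (repr a)) (lam z)).
rewrite -[RHS]loop_class_repr; apply/loop_classP.
rewrite -(concatA_homotopic (reverse (lam y))) concatKp_homotopic.
by rewrite -concatA_homotopic concatpV_homotopic concatp1_homotopic; reflexivity.
Qed.

(** The conjugation is there because [lam x] may be a nontrivial loop. *)
Lemma transport_loop (q : loop_space R x) :
  transport q = (loop_class q ^ (loop_class (lam x))^-1)%g.
Proof.
by rewrite conjgE invgK pi1_invgE mulgA [X in (X * _)%g]pi1_mulgE pi1_mulgE.
Qed.

End Transport.
End PathGroupoid.

(** * The covering of a [pi1]-set *)

(* The covering attached to a right [pi1]-set [F]: its points are [X * F], and a
   path [d] from [y] to [z] carries [(y, f)] to [(z, f . transport d)]. *)
Section ActionCovering.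
Context {R : realType} {X : topologicalType} (x : X).
Variables (lam : forall y, {path unit_interval R from x to y}).
Variables (F : choiceType) (act : F -> pi1 R x -> F).
Local Notation I := (unit_interval R).
Local Notation tau := (transport lam).

(** A separate name, so that the topology defined below is used and not the product topology. *)
Definition action_space : Type := (X * F)%type.

HB.instance Definition _ := Choice.on action_space.

Definition action_open (A : set action_space) : Prop :=
  forall y f, A (y, f) -> exists U, [/\ open U, U y &
    forall z (d : {path I from y to z}), range d `<=` U -> A (z, act f (tau d))].

Lemma action_openT : action_open setT.
Proof. by move=> y f _; exists setT; split=> //; exact: openT. Qed.

Lemma action_openI : setI_closed action_open.
Proof.
move=> A B oA oB y f [/oA[U [oU Uy UA]] /oB[V [oV Vy VB]]].
exists (U `&` V); split=> //; first exact: openI.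
by move=> z d; rewrite subsetI => -[dU dV]; split; [exact: UA|exact: VB].
Qed.

Lemma action_open_bigU (J : Type) (A : J -> set action_space) :
  (forall j, action_open (A j)) -> action_open (\bigcup_j A j).
Proof.
move=> oA y f [j _ /oA[U [oU Uy UA]]].
by exists U; split=> // z d dU; exists j => //; exact: UA.
Qed.

HB.instance Definition _ := isOpenTopological.Build action_space
  action_openT action_openI action_open_bigU.

Lemma action_openE (A : set action_space) : open A = action_open A.
Proof. by []. Qed.

Definition action_map (u : action_space) : X := u.1.

Hypothesis lpcX : locally_path_connected R X.
Hypothesis act1 : forall f, act f 1%g = f.
Hypothesis actM : forall f g h, act f (g * h)%g = act (act f g) h.

Lemma actK f g : act (act f g) g^-1%g = f.
Proof. by rewrite -actM mulgV act1. Qed.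

Lemma actVK f g : act (act f g^-1%g) g = f.
Proof. by rewrite -actM mulVg act1. Qed.

Definition trivializing (U : set X) (y : X) : Prop :=
  [/\ open U, U y, path_connected R U &
      forall (d : {path I from y to y}), range d `<=` U -> forall f, act f (tau d) = f].

Lemma trivializing_act U y z w (d d' : {path I from z to w}) f :
  trivializing U y -> range d `<=` U -> range d' `<=` U ->
  act f (tau d) = act f (tau d').
Proof.
move=> [_ Uy pU trivU] dU d'U.
have Uz := range_zero dU.
have [e eU] := pU y z Uy Uz.
(* Joining [d] and [d'] to [y] by [e] closes them up to a loop at [y] in [U]. It is applied to
   [act f (tau e)^-1] so that the contribution of [e] cancels. *)
have := trivU (concat (concat e d) (reverse (concat e d'))).
rewrite transport_concat transport_reverse => /(_ _ (act f (tau e)^-1%g)).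
move=> /(_ _)/(congr1 (act^~ (tau (concat e d')))).
rewrite actM actVK !transport_concat !actM !actVK; apply.
by apply: range_concat; [|apply: range_reverse]; exact: range_concat.
Qed.

Definition action_sheet (U : set X) (y : X) (f : F) : set action_space :=
  [set u | exists2 d : {path I from y to u.1}, range d `<=` U & u.2 = act f (tau d)].

Lemma action_sheet_open U y f : open U -> open (action_sheet U y f).
Proof.
move=> oU; rewrite action_openE => z _ [/= d dU ->]; exists U; split=> //.
  exact: range_one dU.
move=> w d' d'U; exists (concat d d'); first exact: range_concat.
by rewrite /= transport_concat actM.
Qed.

Lemma action_sheet_base U (u : action_space) : U u.1 -> action_sheet U u.1 u.2 u.
Proof.
by move=> Uu; exists (cst u.1); rewrite ?transport_cst ?act1 // => _ [s _ <-].
Qed.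

Lemma action_map_cts : continuous action_map.
Proof.
apply/continuousP => A oA; rewrite action_openE => y f Ay; exists A; split=> // z d.
exact: range_one.
Qed.

Lemma trivializing_evenly_covered U y :
  trivializing U y -> evenly_covered action_map U.
Proof.
move=> trivU; have [oU Uy pU _] := trivU.
have sheetU f u : action_sheet U y f u -> U u.1.
  by move=> [d dU _]; exact: range_one dU.
exists (range (action_sheet U y)); split.
- apply/seteqP; split=> [[z f] /= Uz|u [_ [f _ <-]]]; last exact: sheetU.
  have [d dU] := pU y z Uy Uz.
  exists (action_sheet U y (act f (tau d)^-1%g)); first exact: imageT.
  by exists d; rewrite //= actVK.
- move=> _ _ [f _ <-] [f' _ <-] [[z g] [[/= d dU gE] [/= d' d'U gE']]].
  have -> : f = f'; last by [].
  rewrite -(actK f (tau d)) -gE gE' (trivializing_act f' trivU d'U dU).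
  exact: actK.
move=> _ [f _ <-]; split; first exact: action_sheet_open.
(* The section has to be total; outside [U] its value [f] is arbitrary. *)
have sec z : exists g, U z -> action_sheet U y f (z, g).
  have [Uz|nUz] := pselect (U z); last by exists f.
  by have [d dU] := pU y z Uy Uz; exists (act f (tau d)) => _; exists d.
have [k kP] := choice sec.
exists (fun z => (z, k z)); split=> //.
- by move=> u; exact: sheetU.
- move=> [z g] /set_mem sg; have Uz := sheetU _ _ sg.
  have [/= d dU ->] := sg; have [/= d' d'U ->] := kP z Uz.
  by rewrite /= (trivializing_act f trivU d'U dU).
split; first by apply: continuous_subspaceT; exact: action_map_cts.
apply: continuous_in_subspaceT => z /set_mem Uz A.
rewrite nbhsE => -[B [oB Bz] BA].
have [V [oV Vz VB]] := oB z (k z) Bz.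
have [W [oW Wz WUV pW]] := lpcX (open_nbhs_nbhs (conj (openI oU oV) (conj Uz Vz))).
apply: filterS (open_nbhs_nbhs (conj oW Wz)) => w Ww; apply: BA.
have [d dW] := pW z w Wz Ww.
have [/= e eU kz] := kP z Uz.
have [/= e' e'U ->] := kP w (WUV w Ww).1.
(* The chosen path [e'] to [w] may be replaced by [e] followed by the short [d], which exhibits the
   value at [w] as that at [z] carried along [d]. *)
rewrite (trivializing_act (d' := concat e d) f trivU e'U).
  by rewrite transport_concat actM -kz; apply: VB => v /dW/WUV[].
by apply: range_concat => // v /dW/WUV[].
Qed.

Hypothesis trivX : forall y, exists U, trivializing U y.

Lemma action_covering : F -> covering_map action_map.
Proof.
move=> f0; split; first exact: action_map_cts.
  by apply/seteqP; split=> // y _; exists (y, f0).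
move=> y; have [U trivU] := trivX y; have [oU Uy _ _] := trivU.
by exists U; split=> //; exact: trivializing_evenly_covered trivU.
Qed.

(** The second coordinate of a path in the covering is governed by transport along its projection.
    This is multiplicative over subdivisions, and on a short interval the path stays in one sheet,
    where transport does not depend on the path. *)
Lemma action_lift (u v : action_space) (G : {path I from u to v}) :
  v.2 = act u.2 (tau (restrict_path
    (comp_continuous (@cts_fun _ _ G) action_map_cts) zero one)).
Proof.
set cg := comp_continuous _ _.
have -> : v.2 = (G one).2 by rewrite path_one.
have -> : u.2 = (G zero).2 by rewrite path_zero.
apply: (unit_interval_chain
  (Q := fun a b => (G b).2 = act (G a).2 (tau (restrict_path cg a b)))).
  move=> a b c _ _ -> ->.
  rewrite -actM -transport_concat; congr act.
  exact/transport_homotopic/restrict_path_concat.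
move=> t; have [U trivU] := trivX (G t).1; have [oU Ut pU _] := trivU.
exists (G @^-1` action_sheet U (G t).1 (G t).2); split.
  apply: (@cts_fun _ _ G); apply: open_nbhs_nbhs; split; first exact: action_sheet_open.
  exact: action_sheet_base.
move=> a b ab sub.
have [d dU Ga] : action_sheet U (G t).1 (G t).2 (G a).
  by apply: sub; rewrite /between /= lexx.
have [e eU Gb] : action_sheet U (G t).1 (G t).2 (G b).
  by apply: sub; rewrite /between /= lexx andbT.
rewrite Ga Gb -actM -transport_concat; apply: (trivializing_act _ trivU) => //.
apply: range_concat => // _ [s _ <-].
have [l lU _] := sub _ (segment_path_between s ab).
exact: range_one lU.
Qed.

Lemma action_lift_ends (y z : X) (d : {path I from y to z}) (f : F) :
  lift_ends action_map d ((y, f) : action_space) (z, act f (tau d)).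
Proof.
have [[z' f'] [G pG] /= zz'] :=
  lift_path (action_covering f) d (e := ((y, f) : action_space)) erefl.
have <- : f' = act f (tau d).
  rewrite [LHS](action_lift G) /=; congr act; apply: transport_eq.
  - by rewrite path_zero.
  - by rewrite path_one.
  - by move=> s; rewrite restrict_path01 pG.
by have -> : (z, f') = (z', f') :> action_space; [rewrite zz'|exists G].
Qed.

Lemma image_subgroup_action (f : F) (q : loop_space R x) :
  image_subgroup R action_map ((x, f) : action_space) x (loop_class q) <->
  act f (tau q) = f.
Proof.
have covp := action_covering f.
have lq := action_lift_ends q f.
split=> [/(image_subgroupP covp lpcX) lq'|actq].
  by have [] := lift_ends_unique covp lq' lq.
by apply/(image_subgroupP covp lpcX); move: lq; rewrite actq.
Qed.

(** Every element of [pi1] is the transport of some path from [x] to a given [y], so by transitivity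
    lifts from [(x, f0)] reach every point. *)
Lemma action_connected (f0 : F) : (forall f, exists g, f = act f0 g) ->
  connected [set: action_space].
Proof.
move=> trans; apply: (path_connected_connected (R := R)).
have path_to y f : exists G : {path I from ((x, f0) : action_space) to (y, f)}, True.
  have [g ->] := trans f; have [d <-] := transport_surj lam x y g.
  by have [G _] := action_lift_ends d f0; exists G.
move=> [y f] [z g] _ _; have [G _] := path_to y f; have [H _] := path_to z g.
by exists (concat (reverse G) H).
Qed.

End ActionCovering.

(** * Small loops, cosets and the classification *)

(* The loops [lam . d . lam^-1] converge in the compact-open topology to
   [lam . 1 . lam^-1] as the loop [d] shrinks to its base point. *)
Lemma small_loops_in_open (R : realType) (X : topologicalType) (x : X)
    (lam : forall y, {path unit_interval R from x to y}) (N : set (pi1 R x)) (y : X) :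
  open N -> N 1%g -> exists2 U, nbhs y U &
    forall d : {path unit_interval R from y to y},
      range d `<=` U -> N (transport lam d).
Proof.
rewrite open_pi1E loop_space_openE => -[B oB BN] N1.
pose I := unit_interval R.
pose l (d : {path I from y to y}) : loop_space R x :=
  concat (concat (lam y) d) (reverse (lam y)).
pose Fl : set_system {compact-open, I -> X} := [set A | exists2 U, nbhs y U &
  forall d : {path I from y to y}, range d `<=` U -> A (l d : I -> X)].
have FFl : Filter Fl.
  split=> [|A C [U Uy UA] [V Vy VC]|A C AC [U Uy UA]].
  - by exists setT => //; exact: filterT.
  - exists (U `&` V); first exact: filterI.
    by move=> d; rewrite subsetI => -[/UA ? /VC ?].
  - by exists U => // d /UA /AC.
have Fl_cvg : Fl --> ((l (cst y) : I -> X) : {compact-open, I -> X}).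
  apply/compact_open_cvgP => K O _ oO l1KO.
  (* The loops [l d] and [l (cst y)] differ only on the middle piece, where the latter equals [y].
     If [y] is not in [O], then [K] misses that piece and [d] needs no constraint. *)
  exists (if `[< O y >] then O else setT).
    by case: asboolP => Oy; [exact: open_nbhs_nbhs|exact: filterT].
  move=> d dU _ [s Ks <-]; have : O (l (cst y) s) by apply: l1KO; exists s.
  rewrite /l !concatE; case: ifP => // _; case: ifP => // _ /= Oy.
  by move: dU; rewrite asboolT //; apply; exact: imageT.
have Bl : B (l (cst y) : I -> X).
  suff : ((fun q : loop_space R x => q : I -> X) @^-1` B) (l (cst y)) by [].
  by rewrite BN /= -/(transport lam (cst y)) transport_cst.
have [U Uy UB] : Fl B by apply: Fl_cvg; exact: open_nbhs_nbhs.
exists U => // d dU.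
suff : (@loop_class R X x @^-1` N) (l d) by [].
by rewrite -BN; exact: UB.
Qed.

Section Cosets.
Context {G : groupType} (H : set G) (sgH : subgroup H).

Definition rcoset_of (g : G) : set G := [set a | H (a * g^-1)%g].

(** Cosets are taken as actual subsets, so that equality of cosets is equality of sets. *)
Definition coset_type : Type := set_type (range rcoset_of).

HB.instance Definition _ := Choice.on coset_type.

Lemma rcoset_of_mul (g h : G) :
  [set a | rcoset_of g (a * h^-1)%g] = rcoset_of (g * h)%g.
Proof. by apply/funext => a; rewrite /rcoset_of /= invgM mulgA. Qed.

Lemma coset_mul_subproof (u : coset_type) (h : G) :
  [set a | (val u : set G) (a * h^-1)%g] \in range rcoset_of.
Proof.
apply/mem_set; case: u => _ /= /set_mem[g _ <-].
by rewrite rcoset_of_mul; exact: imageT.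
Qed.

Definition coset_mul (u : coset_type) (h : G) : coset_type :=
  exist (fun C => C \in range rcoset_of) _ (coset_mul_subproof u h).

Definition coset_of_elt (g : G) : coset_type :=
  exist (fun C => C \in range rcoset_of) _ (mem_set (imageT rcoset_of g)).

Lemma coset_mulE (g h : G) : coset_mul (coset_of_elt g) h = coset_of_elt (g * h)%g.
Proof. by apply: val_inj; exact: rcoset_of_mul. Qed.

Lemma coset_typeP (u : coset_type) : exists g, u = coset_of_elt g.
Proof. by case: u => C C_in; have [g _ gC] := set_mem C_in; exists g; apply: val_inj. Qed.

Lemma coset_mul1 u : coset_mul u 1%g = u.
Proof. by have [g ->] := coset_typeP u; rewrite coset_mulE mulg1. Qed.

Lemma coset_mulM u g h : coset_mul u (g * h)%g = coset_mul (coset_mul u g) h.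
Proof. by have [k ->] := coset_typeP u; rewrite !coset_mulE mulgA. Qed.

Lemma coset_of_eltE (g h : G) : coset_of_elt g = coset_of_elt h <-> H (g * h^-1)%g.
Proof.
have H1 : H 1%g by exact: (set_mem sgH.1).
have HM : forall a b, H a -> H b -> H (a * b)%g.
  by move=> a b /mem_set Ha /mem_set Hb; exact/set_mem/(group_closedM sgH).
have HV a : H a -> H (a^-1)%g.
  by move=> /mem_set Ha; exact/set_mem/(group_closedV sgH).
split=> [/(congr1 val) /= gh|Hgh].
  by suff : rcoset_of h g by []; rewrite -gh /rcoset_of /= mulgV.
apply: val_inj; apply/seteqP; split=> a; rewrite /rcoset_of /= => Ha.
  by have := HM _ _ Ha Hgh; rewrite -mulgA mulKg.
by have := HM _ _ Ha (HV _ Hgh); rewrite invgM invgK -mulgA mulKg.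
Qed.

Lemma core1 : core H 1%g.
Proof. by move=> g _; rewrite conj_setE conj1g; exact: (set_mem sgH.1). Qed.

(** [H k g = H k] means that [k g k^-1] lies in [H], that is, [g] lies in the conjugate of [H] by
    [k]. *)
Lemma core_coset_mul u g : core H g -> coset_mul u g = u.
Proof.
have [k ->] := coset_typeP u => Hg; rewrite coset_mulE; apply/coset_of_eltE.
by have := Hg k I; rewrite conj_setE conjgE invgK mulgA.
Qed.

End Cosets.

Lemma exists_covering (R : realType) (X : topologicalType) (x : X)
    (H : set (pi1 R x)) :
  connected [set: X] -> locally_path_connected R X ->
  subgroup H -> open (core H : set (pi1 R x)) ->
  exists (c : connected_covering X) (e : cover_space c), cover_map e = x /\
    conj_class (image_subgroup R (@cover_map X c) e x) = conj_class H.
Proof.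
move=> connX lpcX sgH oH.
have paths y : exists l : {path unit_interval R from x to y}, True.
  by have [l] := lpc_connecting_path connX lpcX x y; exists l.
pose lam y := projT1 (cid (paths y)).
have act1 := coset_mul1 (H := H); have actM := coset_mulM (H := H).
have trivX y : exists U, trivializing lam (@coset_mul _ H) U y.
  have [U Uy UN] := small_loops_in_open lam y oH (core1 sgH).
  have [V [oV Vy VU pV]] := lpcX y U Uy.
  exists V; split=> // d dV u; apply: (core_coset_mul sgH).
  by apply: UN; exact: subset_trans VU.
have trans (u : coset_type H) : exists g, u = coset_mul (coset_of_elt H 1%g) g.
  by have [g ->] := coset_typeP u; exists g; rewrite coset_mulE mul1g.
have covp := action_covering lpcX act1 actM trivX (coset_of_elt H 1%g).
have connp := action_connected lpcX act1 actM trivX trans.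
exists (ConnectedCovering covp connp), (x, coset_of_elt H 1%g); split=> //=.
(* The subgroup of this covering is the stabilizer of the trivial coset under [transport], which is
   [H] conjugated by the class of [lam x]. *)
rewrite -(conj_class_conj H (loop_class (lam x))); congr conj_class.
apply/funext => a; rewrite -(loop_class_repr a); apply/propext.
rewrite conj_setE -transport_loop.
rewrite (image_subgroup_action lpcX act1 actM trivX) coset_mulE mul1g.
by rewrite (coset_of_eltE sgH) invg1 mulg1.
Qed.

Lemma fiber_inhabited (X : topologicalType) (c : connected_covering X) (x : X) :
  exists e : cover_space c, cover_map e = x.
Proof.
have [_ surj _] := cover_mapP c.
have : range (@cover_map X c) x by rewrite surj.
by move=> [e _ ex]; exists e.
Qed.

Lemma covering_equiv_conj_class (R : realType) (X : topologicalType) (x : X)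
    (c d : connected_covering X) (e : cover_space c) (f : cover_space d) :
  locally_path_connected R X -> cover_map e = x -> cover_map f = x ->
  covering_equiv c d <->
  conj_class (image_subgroup R (@cover_map X c) e x) =
    conj_class (image_subgroup R (@cover_map X d) f x).
Proof.
move=> lpcX ce df; have covc := cover_mapP c; have covd := cover_mapP d.
split=> [[h [[k [hk kh ch ck]] hE]]|/conj_class_eq[g fg]]; last first.
  (* Moving the base point of [c] within the fibre absorbs the conjugation and makes the two
     subgroups equal. *)
  have [e' ce' eg] := image_subgroup_conjE covc lpcX g ce.
  by apply: (covering_equiv_image_subgroup lpcX ce' df); rewrite fg eg.
have kE z : cover_map (k z) = cover_map z by rewrite -hE kh.
have dhe : cover_map (h e) = x by rewrite hE.
have [g ->] := image_subgroup_conj_fiber covd lpcX (@cover_connected _ d) dhe df.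
rewrite conj_class_conj; congr conj_class; apply/seteqP; split.
  exact: image_subgroup_covering_equiv.
by rewrite -{2}(hk e); exact: image_subgroup_covering_equiv.
Qed.

Theorem theorem3p7 (R : realType) (X : topologicalType) (x : X)
    (Xconnected : connected [set: X])
    (Xlpc : locally_path_connected R X) :
  exists f : covering_class X -> set_type (open_core_classes R x),
    bijective f /\
    forall (c : connected_covering X) (e : cover_space c),
      cover_map e = x ->
      set_val (f (class_of c)) =
        conj_class (image_subgroup R (@cover_map X c) e x).
Proof.
(* The value at a class is specified for all representatives and base points at once, so the choice
   below needs no separate check of well-definedness. *)
have exf (C : covering_class X) : exists A : set_type (open_core_classes R x),
    forall c (e : cover_space c), C = class_of c -> cover_map e = x ->
      set_val A = conj_class (image_subgroup R (@cover_map X c) e x).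
  have [c ->] := class_of_surj C; have [e ce] := fiber_inhabited c x.
  have covc := cover_mapP c.
  have inA : open_core_classes R x (conj_class (image_subgroup R (@cover_map X c) e x)).
    exists (image_subgroup R (@cover_map X c) e x) => //; split.
      exact: image_subgroup_subgroup.
    exact: open_core_image_subgroup (@cover_connected _ c) _ ce.
  exists (SigSub (mem_set inA)) => d f /class_ofP cd df; rewrite set_valE /=.
  exact/(covering_equiv_conj_class Xlpc ce df).
have [f fP] := choice exf.
have fE c (e : cover_space c) : cover_map e = x ->
    set_val (f (class_of c)) = conj_class (image_subgroup R (@cover_map X c) e x).
  exact: fP.
exists f; split=> //.
have f_surj A : exists C, f C = A.
  case: A => A inA; have [H [sgH oH] HA] := set_mem inA.
  have [c [e [ce cH]]] := exists_covering Xconnected Xlpc sgH oH.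
  by exists (class_of c); apply: val_inj; rewrite -set_valE (fE c e ce) cH HA.
have f_inj : injective f.
  move=> C D; have [c ->] := class_of_surj C; have [d ->] := class_of_surj D.
  have [e ce] := fiber_inhabited c x; have [e' de'] := fiber_inhabited d x.
  move=> /(congr1 set_val); rewrite (fE c e ce) (fE d e' de') => cd.
  exact/class_ofP/(covering_equiv_conj_class Xlpc ce de').
have [g gP] := choice f_surj.
by exists g => // C; apply: f_inj; rewrite gP.
Qed.
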